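(* Let $X_1, X_2, \ldots$ be i.i.d.\ with $\mathbb{P}\{X_1 = 2^k\} = 2^{-k}$, $k \in \mathbb{N}$, let $S_n = X_1 + \cdots + X_n$, $X_n^* = \max_{1 \leq i \leq n} X_i$, and $\gamma_n = n/2^{\lceil \log_2 n\rceil}$. Then \[ \sup_{x \in \mathbb{R}} \left| \mathbb{P}\left\{ \frac{S_n - X_n^*}{n} - \log_2 n \leq x\right\} - G^*_{\gamma_n}(x)\right| \to 0, \quad n \to \infty, \] where for $\gamma \in (1/2,1]$ \[ G^*_\gamma(x) = \sum_{j=-\infty}^\infty \sum_{m=1}^\infty G_{j-1,\gamma}\left(x - (m-1)2^j/\gamma\right) r_{j,\gamma}(m)\, p_{j,\gamma}. \]
   Context: For $j \in \mathbb{Z}$ and $\gamma \in [1/2,1]$: $p_{j,\gamma} = e^{-\gamma 2^{-j}}(1 - e^{-\gamma 2^{-j}})$; $r_{j,\gamma}(m) = \frac{(2^{-j}\gamma)^m}{m!}\left(e^{2^{-j}\gamma}-1\right)^{-1}$ for $m \geq 1$ (a Poisson$(\gamma 2^{-j})$ law conditioned to be nonzero); $G_{j,\gamma}$ is the distribution function of the infinitely divisible random variable $W_{j,\gamma}$ with characteristic function \[ \mathbb{E} e^{\mathrm{i} t W_{j,\gamma}} = \exp\left[ \mathrm{i} t u_{j,\gamma} + \int_0^\infty \left(e^{\mathrm{i} t x} - 1 - \mathrm{i} t x\right) \mathrm{d} L_{j,\gamma}(x)\right], \] where $u_{j,\gamma} = j - \log_2 \gamma$ and $L_{j,\gamma}(x)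 = \gamma 2^{-j} - \frac{2^{\{\log_2(\gamma x)\}}}{x}$ for $0 < x < 2^j \gamma^{-1}$, $L_{j,\gamma}(x) = 0$ for $x \geq 2^j\gamma^{-1}$. Here $\{y\}$ is the fractional part of $y$. *)

(* Defs.v *)
From HB Require Import structures.
From mathcomp Require Import all_boot all_order all_algebra.
From mathcomp Require Import all_classical all_reals all_analysis.
Set Implicit Arguments. Unset Strict Implicit. Unset Printing Implicit Defensive.
Import Order.TTheory GRing.Theory Num.Theory.
Import numFieldNormedType.Exports.
Local Open Scope classical_set_scope.
Local Open Scope ring_scope.

Section defs.
Variable R : realType.

Definition log2 (x : R) : R := ln x / ln 2.

Definition frac (y : R) : R := y - (Num.floor y)%:~R.

Definition pow2neg (j : int) : R := (2 : R) ^ (- j).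

Definition p_jg (j : int) (g : R) : R :=
  expR (- (g * pow2neg j)) * (1 - expR (- (g * pow2neg j))).

Definition r_jg (j : int) (g : R) (m : nat) : R :=
  (pow2neg j * g) ^+ m / (m`!)%:R * (expR (pow2neg j * g) - 1)^-1.

Definition u_jg (j : int) (g : R) : R := j%:~R - log2 g.

(* L_{j,gamma}(x), for x > 0 *)
Definition L_jg (j : int) (g : R) (x : R) : R :=
  if x < (2 : R) ^ j / g then g * pow2neg j - 2 `^ (frac (log2 (g * x))) / x
  else 0.

Definition is_levy_measure_of (L : R -> R) (nu : {measure set R -> \bar R}) :=
  forall a b : R, 0 < a -> a <= b -> nu [set` `]a, b]] = (L b - L a)%:E.

(* G is the distribution function of the infinitely divisible variable W_{j,g}:
   there is a probability law mu on R with distribution function G whose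
   characteristic function is
   exp[ i t u + int_0^oo (e^{itx} - 1 - itx) dL(x) ],
   written out through real and imaginary parts. *)
Definition is_df_W (j : int) (g : R) (G : R -> R) : Prop :=
  exists (mu : probability R R) (nu : {measure set R -> \bar R}),
    is_levy_measure_of (L_jg j g) nu /\
    (forall x, G x = fine (mu [set` `]-oo, x]])) /\
    forall t : R,
      let A := Rintegral nu [set` `]0, +oo[] (fun x => cos (t * x) - 1) in
      let B := Rintegral nu [set` `]0, +oo[] (fun x => sin (t * x) - t * x) in
      Rintegral mu setT (fun x => cos (t * x)) = expR A * cos (t * u_jg j g + B) /\
      Rintegral mu setT (fun x => sin (t * x)) = expR A * sin (t * u_jg j g + B).

Definition Gstar (G : int -> R -> R -> R) (g : R) (x : R) : \bar R :=
  (\esum_(jm in [set: int * nat])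
     (G (jm.1 - 1) g (x - (jm.2)%:R * (2 : R) ^ jm.1 / g)
      * r_jg jm.1 g jm.2.+1 * p_jg jm.1 g)%:E)%R.

Definition mutually_independent d (T : measurableType d) (P : probability T R)
  (X : nat -> T -> R) : Prop :=
  forall (n : nat) (B : nat -> set R), (forall i, measurable (B i)) ->
    P (\bigcap_(i < n) (X i @^-1` B i)) =
    (\prod_(i < n) fine (P (X i @^-1` B i)))%:E.

End defs.

(* Main.v *)
Require Import Defs.
From HB Require Import structures.
From mathcomp Require Import all_boot all_order all_algebra.
From mathcomp Require Import all_classical all_reals all_analysis.
From mathcomp Require Import measurable_realfun.
From mathcomp Require Import complex.
From mathcomp Require Import ring lra zify.
Import Order.TTheory GRing.Theory Num.Theory.
Import numFieldNormedType.Exports.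
Import ComplexField.Normc.
Local Open Scope classical_set_scope.
Local Open Scope ring_scope.
Set Implicit Arguments. Unset Strict Implicit. Unset Printing Implicit Defensive.

(** Proof idea. For j in Z, the event that the maximum equals 2^K, K = ceil(log2 n) + j,
    and is attained exactly m times is a disjoint union of elementary events
    {X_1 = 2^(l_1), ..., X_n = 2^(l_n)}. On it the trimmed sum is a sum of n - m variables
    truncated at 2^(K-1), shifted by (m-1) 2^K; its Fourier transform is read off the
    generating polynomial (psi + c 'X)^n and is O(log^2 n / n)-close to
    r_{j,gamma}(m) p_{j,gamma} times that of W_{j-1,gamma}, because psi^n ~ exp (n (psi - 1))
    and the Levy measure of W_{j,gamma} is purely atomic, with mass b_k = gamma 2^(k-j) at
    1/b_k, k >= 0. Fourier transforms are compared with distribution functions without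
    inversion: a polynomial in sin((y - x)/L) approximates the indicator of (-oo, x] on a long
    interval, second moments control the tails, and the decay
    |E exp(i t W)| <= exp(-|t|/8) for large t bounds the mass of short intervals, uniformly
    in gamma. Finally finitely many (j, m) carry almost all the weight, uniformly in gamma,
    since p_{j,gamma} telescopes in j. *)

(** * Elementary inequalities and the complex exponential *)

(** The fractional part of log2 n makes gamma_n oscillate, so there is no single limit law: both
    laws compared move with n, and every estimate must be uniform for a in a compact part of (0,
    oo). Each pair (j, m) gives a measure of mass at most one, which is never normalised: with l =
    gamma 2^(-j) one has r p = l^m / m! e^(-2l), where l^m / m! comes from the Poisson count of
    maxima and e^(-2l) is the asymptotic probability that the other variables stay below the
    maximum. The comparison rests on an exact identity: if n = a 2^k and X is truncated at 2^k, then
    n (psi - 1) equals -a + i t k plus the k-th partial sum of the series for the Levy exponent.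
    Here -a, with a = 2l, produces e^(-2l), and the divergent drift t k cancels against log2 n =
    log2 a + k. The law of X enters only through finitely many elementary events; what the finite
    box of (j, m) misses is at most one minus its mass, so the other pairs are never estimated one
    by one. *)

Section elementary.
Variable R : realType.
Implicit Types x y a b t : R.

Lemma derive_ge0_le (f df : R -> R) x :
  (forall y, is_derive y 1 f (df y)) -> (forall y, 0 <= y -> 0 <= df y) ->
  0 <= x -> f 0 <= f x.
Proof.
move=> fd df0 x0; apply: (@ger0_derive1_ndecry R f 0) => //.
- move=> y; rewrite in_itv/= andbT => /ltW y0.
  by rewrite derive1E derive_val df0.
- apply: derivable_within_continuous => y _; case: (fd y) => h _; exact: h.
Qed.

Lemma sin_le x : 0 <= x -> sin x <= x.
Proof.
move=> x0; rewrite -subr_ge0.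
have := @derive_ge0_le (fun y => y - sin y) (fun y => 1 - cos y) x.
rewrite sin0 subrr; by apply => // y _; rewrite subr_ge0 cos_le1.
Qed.

Lemma norm_sin_le x : `|sin x| <= `|x|.
Proof.
wlog x0 : x / 0 <= x => [H|].
  have [/H//|x0] := leP 0 x.
  by have := H (- x); rewrite sinN !normrN; apply; rewrite oppr_ge0 ltW.
rewrite [leRHS]ger0_norm// ler_norml sin_le// andbT.
have [x1|x1] := leP x 1; last by have := sin_geN1 x; lra.
suff : 0 <= sin x by lra.
by apply: sin_ge0_pi; rewrite x0/=; have := @pi_ge2 R; lra.
Qed.

Lemma cos_halfE x : cos x = 1 - 2 * sin (x / 2) ^+ 2.
Proof.
have -> : cos x = cos ((x / 2) *+ 2) by congr cos; rewrite -mulr_natr; field.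
by rewrite cos_mulr2n cos2sin2; ring.
Qed.

Lemma cos_ge_quad x : 1 - x ^+ 2 / 2 <= cos x.
Proof.
rewrite cos_halfE.
have : sin (x / 2) ^+ 2 <= (x / 2) ^+ 2.
  by rewrite -real_normK ?num_real// -[leRHS]real_normK ?num_real// lerXn2r ?nnegrE// norm_sin_le.
by rewrite expr_div_n; lra.
Qed.

Lemma sin_ge_quad x : 0 <= x -> x - x ^+ 2 / 2 <= sin x.
Proof.
move=> x0; rewrite -subr_ge0.
have := @derive_ge0_le (fun y => sin y - (y - y ^+ 2 / 2)) (fun y => cos y - (1 - y)) x.
rewrite sin0 expr0n/= mul0r !subr0; apply => //.
- move=> y; apply: is_derive_eq.
  by rewrite /GRing.scale/= ; field.
(* The derivative is y - 2 sin(y/2)^2, and sin^2 <= |sin| <= y/2. *)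
- move=> y y0; rewrite cos_halfE.
  have s1 := norm_sin_le (y / 2).
  have s2 := sin_max (y / 2).
  have : sin (y / 2) ^+ 2 <= y / 2.
    rewrite -real_normK ?num_real// expr2.
    rewrite (le_trans (ler_piMl _ s2))// (le_trans s1)//.
    by rewrite ger0_norm// divr_ge0.
  by lra.
Qed.

Lemma norm_sin_subr x : `|sin x - x| <= x ^+ 2 / 2.
Proof.
wlog x0 : x / 0 <= x => [H|].
  have [/H//|x0] := leP 0 x.
  have := H (- x); rewrite sinN sqrrN -opprD normrN; apply.
  by rewrite oppr_ge0 ltW.
have := sin_le x0; have := sin_ge_quad x0 => h1 h2.
by rewrite ler_norml; lra.
Qed.

Lemma norm_cos_sub1 x : `|cos x - 1| <= x ^+ 2 / 2.
Proof.
have := cos_ge_quad x; have := cos_le1 x => h1 h2.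
by rewrite ler_norml; lra.
Qed.

Lemma cos_le_quad x : `|x| <= 1 -> cos x <= 1 - x ^+ 2 / 4.
Proof.
wlog x0 : x / 0 <= x => [H|].
  have [/H//|x0] := leP 0 x.
  have := H (- x); rewrite cosN sqrrN normrN; apply.
  by rewrite oppr_ge0 ltW.
rewrite ger0_norm// => x1; rewrite cos_halfE.
have h : 0 <= x / 2 by rewrite divr_ge0.
have := sin_ge_quad h.
set s := sin _ => hs.
(* [hs] at h = x/2 <= 1/2 gives sin h >= h (1 - h/2) >= (3/4) h; squaring, 2 (9/16) (x/2)^2 = (9/32)
   x^2 >= x^2 / 4. *)
have : (3 / 4 * (x / 2)) ^+ 2 <= s ^+ 2.
  rewrite lerXn2r ?nnegrE//; nra.
nra.
Qed.

(** e^x = 1/e^(-x) <= 1/(1 - x), and (1 + x + x^2)(1 - x) = 1 - x^3 >= 1 for x <= 0. *)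
Lemma expR_le_quad x : x <= 0 -> expR x <= 1 + x + x ^+ 2.
Proof.
move=> x0.
rewrite -[x]opprK expRN invf_ple ?posrE ?expR_gt0//; last by nra.
apply: le_trans (expR_ge1Dx _).
rewrite -[leLHS]mul1r ler_pdivrMr; nra.
Qed.

Lemma expR_neg_le x : 0 <= x -> expR (- x) <= (1 + x)^-1.
Proof.
move=> x0; rewrite expRN lef_pV2 ?posrE ?expR_gt0//; last by lra.
exact: expR_ge1Dx.
Qed.

End elementary.

Section complex_exponential.
Variable R : realType.
Implicit Types x y a b t : R.
Implicit Types z w : R[i].
Local Open Scope complex_scope.

(** This is exp(a + i b); the two parts of the exponent stay separate because their limits are two
    real series. *)
Definition cexp a b : R[i] := (expR a * cos b) +i* (expR a * sin b).
Local Notation nc := (@normc R).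

Lemma ler_normcD z w : nc (z + w) <= nc z + nc w.
Proof. exact: le_normcD. Qed.

Lemma normcNE z : nc (- z) = nc z.
Proof. exact: normcN. Qed.

Lemma normc_ge0 z : 0 <= nc z.
Proof. by case: z => a b /=; exact: sqrtr_ge0. Qed.

Lemma ler_normcB z w : nc (z - w) <= nc z + nc w.
Proof. by rewrite -(normcNE w) ler_normcD. Qed.

Lemma normcX z n : nc (z ^+ n) = nc z ^+ n.
Proof.
elim: n => [|n ih]; first by rewrite !expr0 normc1.
by rewrite !exprS normcM ih.
Qed.

Lemma normc_real a : nc a%:C = `|a|.
Proof. by rewrite /= expr0n/= addr0 sqrtr_sqr. Qed.

Lemma ler_normc_sum (I : Type) (s : seq I) (P : pred I) (F : I -> R[i]) :
  nc (\sum_(i <- s | P i) F i) <= \sum_(i <- s | P i) nc (F i).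
Proof.
elim/big_rec2: _ => [|i u v _ h]; first by rewrite normc0.
by rewrite (le_trans (ler_normcD _ _))// lerD2l.
Qed.

Lemma Re_sum (I : Type) (s : seq I) (P : pred I) (F : I -> R[i]) :
  complex.Re (\sum_(i <- s | P i) F i) = \sum_(i <- s | P i) complex.Re (F i).
Proof. by apply: (big_morph (fun z : R[i] => complex.Re z)) => // -[a b] [c d]. Qed.

Lemma Im_sum (I : Type) (s : seq I) (P : pred I) (F : I -> R[i]) :
  complex.Im (\sum_(i <- s | P i) F i) = \sum_(i <- s | P i) complex.Im (F i).
Proof. by apply: (big_morph (fun z : R[i] => complex.Im z)) => // -[a b] [c d]. Qed.

Lemma normc_Re z : `|complex.Re z| <= nc z.
Proof.
case: z => a b /=.
by rewrite -sqrtr_sqr ler_wsqrtr// lerDl sqr_ge0.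
Qed.

Lemma normc_Im z : `|complex.Im z| <= nc z.
Proof.
case: z => a b /=.
by rewrite -sqrtr_sqr ler_wsqrtr// lerDr sqr_ge0.
Qed.

Lemma normc_le_ReIm z : nc z <= `|complex.Re z| + `|complex.Im z|.
Proof.
case: z => a b /=.
rewrite -(@ger0_norm _ (`|a| + `|b|)) ?addr_ge0// -sqrtr_sqr ler_wsqrtr//.
rewrite sqrrD !real_normK ?num_real//.
have : 0 <= `|a| * `|b| by rewrite mulr_ge0.
lra.
Qed.

Lemma cexpD a b c d : cexp (a + c) (b + d) = cexp a b * cexp c d.
Proof.
rewrite /cexp expRD cosD sinD; apply/eqP; rewrite eq_complex /=.
by apply/andP; split; apply/eqP; ring.
Qed.

Lemma cexp00 : cexp 0 0 = 1.
Proof. by rewrite /cexp expR0 cos0 sin0 mulr1 mulr0. Qed.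

Lemma cexpXn a b n : cexp a b ^+ n = cexp (a *+ n) (b *+ n).
Proof.
elim: n => [|n ih]; first by rewrite expr0 !mulr0n cexp00.
by rewrite exprS ih !mulrS cexpD.
Qed.

Lemma cexp_sum (I : Type) (s : seq I) (F : I -> R) :
  cexp 0 (\sum_(i <- s) F i) = \prod_(i <- s) cexp 0 (F i).
Proof.
elim/big_rec2: _ => [|i u v _ h]; first by rewrite cexp00.
by rewrite -[X in cexp X _](addr0 0) cexpD h.
Qed.

Lemma normc_cexp a b : nc (cexp a b) = expR a.
Proof.
rewrite /cexp /=.
have -> : (expR a * cos b) ^+ 2 + (expR a * sin b) ^+ 2 = expR a ^+ 2.
  by rewrite !exprMn -mulrDr cos2Dsin2 mulr1.
by rewrite sqrtr_sqr ger0_norm ?expR_ge0.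
Qed.

(** For a <= 0 the factor expR a is at most 1, so the Taylor remainder is purely quadratic; the
    cross term |a| |b| is at most half of a^2 + b^2. *)
Lemma normc_cexp_sub1 a b : a <= 0 ->
  nc (cexp a b - 1 - (a +i* b)) <= 2 * (a ^+ 2 + b ^+ 2).
Proof.
move=> a0; apply: (le_trans (normc_le_ReIm _)); rewrite /= oppr0 addr0.
have e1 : expR a <= 1 by rewrite -expR0 ler_expR.
have e0 := expR_gt0 a.
have e2 := expR_ge1Dx a; have e3 := expR_le_quad a0.
have c1 : `|expR a * cos b - 1 - a| <= a ^+ 2 + b ^+ 2 / 2.
  have -> : expR a * cos b - 1 - a = (expR a - 1 - a) + expR a * (cos b - 1) by ring.
  apply: (le_trans (ler_normD _ _)); apply: lerD.
    by rewrite ger0_norm; lra.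
  rewrite normrM (ger0_norm (ltW e0)).
  apply: le_trans (norm_cos_sub1 b).
  by rewrite ler_piMl.
have c2 : `|expR a * sin b - b| <= b ^+ 2 / 2 + `|b| * `|a|.
  have -> : expR a * sin b - b = expR a * (sin b - b) + b * (expR a - 1) by ring.
  apply: (le_trans (ler_normD _ _)); apply: lerD.
    rewrite normrM (ger0_norm (ltW e0)).
    apply: le_trans (norm_sin_subr b).
    by rewrite ler_piMl.
  rewrite normrM ler_wpM2l//.
  by rewrite (ler0_norm a0) ler_norml; lra.
have h : `|b| * `|a| <= (a ^+ 2 + b ^+ 2) / 2.
  have := sqr_ge0 (`|b| - `|a|); rewrite sqrrB -!normrX !(ger0_norm (sqr_ge0 _)).
  lra.
have := sqr_ge0 a; have := sqr_ge0 b; lra.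
Qed.

Lemma normc_cexp0_sub1 b : nc (cexp 0 b - 1 - (0 +i* b)) <= b ^+ 2.
Proof.
apply: (le_trans (normc_le_ReIm _)); rewrite /= expR0 ?mul1r ?oppr0 ?addr0 ?subr0.
have := norm_cos_sub1 b; have := norm_sin_subr b; lra.
Qed.

(** Telescoping: the n factors are exchanged one at a time, and all the others have modulus at most
    1. *)
Lemma normc_expB z w n : nc z <= 1 -> nc w <= 1 ->
  nc (z ^+ n - w ^+ n) <= n%:R * nc (z - w).
Proof.
move=> z1 w1; elim: n => [|n ih]; first by rewrite !expr0 subrr normc0 mul0r.
have -> : z ^+ n.+1 - w ^+ n.+1 = (z - w) * z ^+ n + w * (z ^+ n - w ^+ n).
  by rewrite !exprS; ring.
apply: (le_trans (ler_normcD _ _)); rewrite !normcM normcX.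
rewrite -natr1 mulrDl mul1r addrC lerD//.
  by rewrite (le_trans _ ih)// ler_piMl// normc_ge0.
by rewrite ler_piMr ?normc_ge0// exprn_ile1// normc_ge0.
Qed.

End complex_exponential.

(** * From Fourier transforms to distribution functions *)

Section smooth_step.
Variable R : realType.
Implicit Types x y a b t d e h L : R.

(** Phases make sines unnecessary and keep the class closed under products and translations. *)
Definition trig (f : R -> R) := exists s : seq (R * R * R),
  forall y, f y = \sum_(p <- s) p.1.1 * cos (p.1.2 * y + p.2).

Lemma trig_cst c : trig (fun=> c).
Proof. by exists [:: (c, 0, 0)] => y; rewrite big_seq1 mul0r addr0 cos0 mulr1. Qed.

Lemma trigD f g : trig f -> trig g -> trig (fun y => f y + g y).
Proof.
by move=> [s sf] [s' sg]; exists (s ++ s') => y; rewrite big_cat/= -sf -sg.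
Qed.

Lemma trigMcos f c t b : trig f -> trig (fun y => f y * (c * cos (t * y + b))).
Proof.
move=> [s sf].
exists ([seq (p.1.1 * c / 2, p.1.2 + t, p.2 + b) | p <- s] ++
        [seq (p.1.1 * c / 2, p.1.2 - t, p.2 - b) | p <- s]) => y.
rewrite big_cat/= !big_map -big_split/= sf mulr_suml.
apply: eq_bigr => -[[u v] w] _ /=.
have -> : (v + t) * y + (w + b) = (v * y + w) + (t * y + b) by ring.
have -> : (v - t) * y + (w - b) = (v * y + w) - (t * y + b) by ring.
rewrite (cosB (v * y + w)) (cosD (v * y + w)); by field.
Qed.

Lemma trigM f g : trig f -> trig g -> trig (fun y => f y * g y).
Proof.
move=> tf [s sg].
have -> : (fun y => f y * g y) =
    (fun y => \sum_(p <- s) f y * (p.1.1 * cos (p.1.2 * y + p.2))).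
  by apply/funext => y; rewrite sg mulr_sumr.
elim: s {sg} => [|p s ih].
  by under eq_fun do rewrite big_nil; exact: trig_cst.
by under eq_fun do rewrite big_cons; apply: trigD ih; exact: trigMcos.
Qed.

Lemma trigX f n : trig f -> trig (fun y => f y ^+ n).
Proof.
move=> tf; elim: n => [|n ih].
  by under eq_fun do rewrite expr0; exact: trig_cst.
by under eq_fun do rewrite exprS; exact: trigM.
Qed.

Lemma Bernoulli_ineq x n : -1 <= x -> 1 + n%:R * x <= (1 + x) ^+ n.
Proof.
move=> x1; elim: n => [|n ih]; first by rewrite mul0r addr0 expr0.
rewrite exprSr.
have h : 0 <= 1 + x by lra.
apply: (le_trans _ (ler_wpM2r h ih)).
have : 0 <= n%:R * (x ^+ 2) :> R by rewrite mulr_ge0// sqr_ge0.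
by rewrite -natr1; nra.
Qed.

Lemma expr_sub1_le x n : 0 <= x <= 1 -> (1 - x) ^+ n <= (1 + n%:R * x)^-1.
Proof.
move=> /andP[x0 x1].
have p : 0 < 1 + n%:R * x.
  have : 0 <= n%:R * x by rewrite mulr_ge0.
  by lra.
rewrite -[leRHS]mul1r ler_pdivlMr//.
have h : 1 + n%:R * x <= (1 + x) ^+ n by apply: Bernoulli_ineq; lra.
have h0 : 0 <= (1 - x) ^+ n by rewrite exprn_ge0// subr_ge0.
apply: (le_trans (ler_wpM2l h0 h)).
rewrite -exprMn exprn_ile1//; nra.
Qed.

(* The classical approximation of a step at 1/2 on [0, 1]. *)
Definition step_poly N x := (1 - x ^+ N) ^+ (2 ^ N).

Lemma step_poly01 N x : 0 <= x <= 1 -> 0 <= step_poly N x <= 1.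
Proof.
move=> /andP[x0 x1].
have h : x ^+ N <= 1 by rewrite exprn_ile1.
have h' : 0 <= x ^+ N by rewrite exprn_ge0.
by rewrite /step_poly exprn_ge0 ?subr_ge0//= exprn_ile1//; lra.
Qed.

(** Bernoulli gives (1 - x^N)^(2^N) >= 1 - (2x)^N, and (2x)^N <= (1 - d)^N <= 1/(1 + N d). *)
Lemma step_poly_low N d x : 0 <= x -> x <= (1 - d) / 2 -> 0 <= d ->
  1 - (1 + N%:R * d)^-1 <= step_poly N x.
Proof.
move=> x0 xd d0.
have d1 : d <= 1 by lra.
have h' : 0 <= x ^+ N by rewrite exprn_ge0.
have h1 : x ^+ N <= 1 by rewrite exprn_ile1//; lra.
apply: le_trans (_ : 1 + (2 ^ N)%:R * (- x ^+ N) <= _); last first.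
  by apply: Bernoulli_ineq; lra.
rewrite mulrN lerD2l lerN2 natrX -exprMn.
have /(le_trans _) : (1 - d) ^+ N <= (1 + N%:R * d)^-1.
  by apply: expr_sub1_le; rewrite d0.
by apply; rewrite lerXn2r ?nnegrE//; lra.
Qed.

(** Here (1 - x^N)^(2^N) <= 1/(1 + (2x)^N), and (2x)^N >= (1 + d)^N >= 1 + N d. *)
Lemma step_poly_high N d x : x <= 1 -> (1 + d) / 2 <= x -> 0 <= d ->
  step_poly N x <= (1 + N%:R * d)^-1.
Proof.
move=> x1 xd d0.
have x0 : 0 <= x by lra.
have h' : 0 <= x ^+ N by rewrite exprn_ge0.
have h1 : x ^+ N <= 1 by rewrite exprn_ile1//; lra.
apply: (le_trans (expr_sub1_le _ _)); first by rewrite h'.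
have p : 0 < 1 + N%:R * d.
  have : 0 <= N%:R * d by rewrite mulr_ge0.
  by lra.
have h : 1 + N%:R * d <= (2 ^ N)%:R * x ^+ N.
  rewrite natrX -exprMn.
  apply: (@le_trans _ _ ((1 + d) ^+ N)); first by apply: Bernoulli_ineq; lra.
  by rewrite lerXn2r ?nnegrE//; lra.
rewrite lef_pV2 ?posrE//; lra.
Qed.

Lemma sin_ge_half x : 0 <= x <= 1 -> x / 2 <= sin x.
Proof. by move=> /andP[x0 x1]; have := sin_ge_quad x0; nra. Qed.

Lemma exists_nat_inv_le d e : 0 < d -> 0 < e ->
  exists N : nat, forall n, (N <= n)%N -> (1 + n%:R * d)^-1 <= e.
Proof.
move=> d0 e0.
have [N hN] : exists N : nat, (e * d)^-1 <= N%:R.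
  exists (Num.bound (e * d)^-1).
  by have := archi_boundP (ltW (_ : 0 < (e * d)^-1)); rewrite invr_gt0 mulr_gt0// => /(_ isT)/ltW.
exists N => n Nn.
have hn : (e * d)^-1 <= n%:R by rewrite (le_trans hN)// ler_nat.
rewrite -[e]invrK lef_pV2 ?posrE ?invr_gt0//; last first.
  have : 0 <= n%:R * d by rewrite mulr_ge0// ltW.
  lra.
have : e^-1 <= n%:R * d.
  rewrite -ler_pdivrMr//; move: hn; rewrite invfM.
  by rewrite mulrC.
lra.
Qed.

(** The step is [step_poly] composed with (1 + sin(u/L))/2, which crosses 1/2 at u = 0. For h <= u
    <= L, u/L <= 1 gives sin(u/L) >= u/(2L) >= h/(2L), the gap [d]. Far beyond L the sine turns
    back, so only 0 <= q <= 1 is claimed there. *)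
Lemma trig_step h L e : 0 < h -> 0 < L -> 0 < e ->
  exists q : R -> R, [/\ trig q, forall u, 0 <= q u <= 1,
    forall u, - L <= u <= - h -> 1 - e <= q u &
    forall u, h <= u <= L -> q u <= e].
Proof.
move=> h0 L0 e0.
pose d := h / (2 * L).
have d0 : 0 < d by rewrite divr_gt0// mulr_gt0.
have [N /(_ N (leqnn _)) hN] := exists_nat_inv_le d0 e0.
pose t u := (1 + sin (u / L)) / 2.
have t01 u : 0 <= t u <= 1.
  by have := sin_geN1 (u / L); have := sin_le1 (u / L); rewrite /t; lra.
have sind u : h <= u <= L -> d <= sin (u / L).
  move=> /andP[hu uL].
  have : 0 <= u / L <= 1.
    by rewrite divr_ge0 ?(ltW L0) ?(le_trans (ltW h0))//= ler_pdivrMr// mul1r.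
  move=> /sin_ge_half; apply: le_trans.
  rewrite /d invfM mulrA [leLHS]mulrAC ler_pM2r// ler_pM2r//.
  by rewrite invr_gt0.
exists (fun u => step_poly N (t u)); split.
- rewrite /step_poly /t; apply: trigX.
  apply: trigD; first exact: trig_cst.
  have -> : (fun y => - ((1 + sin (y / L)) / 2) ^+ N) =
     (fun y => (fun=> -1) y * ((1 + sin (y / L)) / 2) ^+ N).
    by apply/funext => y; rewrite mulN1r.
  apply: trigM; first exact: trig_cst.
  apply: trigX; apply: trigM; last exact: trig_cst.
  apply: trigD; first exact: trig_cst.
  exists [:: (1, L^-1, - (pi / 2))] => y; rewrite big_seq1/= mul1r cosBpihalf.
  by rewrite mulrC.
- by move=> u; apply: step_poly01.
- move=> u uh.
  have : d <= sin (- u / L) by apply: sind; lra.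
  rewrite mulNr sinN => hs.
  have /andP[tu0 tu1] := t01 u.
  apply: (@le_trans _ _ (1 - (1 + N%:R * d)^-1)); first by lra.
  apply: step_poly_low => //; rewrite ?(ltW d0)// /t; lra.
- move=> u uh; have hs := sind _ uh.
  have /andP[tu0 tu1] := t01 u.
  apply: le_trans hN.
  apply: step_poly_high => //; rewrite ?(ltW d0)// /t; lra.
Qed.

End smooth_step.

(** * Positive functionals and their Fourier transforms *)

Section positive_functionals.
Variable R : realType.
Implicit Types (x y a b c t d e h r C L T : R) (f g : R -> R) (I J : (R -> R) -> R).

Definition bmf f := measurable_fun setT f /\ exists M, forall x, `|f x| <= M.

(** One interface for the two kinds of measures compared: finite weighted sums over configurations
    and integrals against a probability law. *)
Record posfun I : Prop := PosFun {
  pfD : forall f g, bmf f -> bmf g -> I (fun x => f x + g x) = I f + I g;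
  pfZ : forall c f, bmf f -> I (fun x => c * f x) = c * I f;
  pf_le : forall f g, bmf f -> bmf g -> (forall x, f x <= g x) -> I f <= I g }.

Lemma bmf_cst c : bmf (fun=> c).
Proof. by split; [exact: measurable_cst|exists `|c|]. Qed.

Lemma bmfD f g : bmf f -> bmf g -> bmf (fun x => f x + g x).
Proof.
move=> [mf [M hM]] [mg [M' hM']]; split; first exact: measurable_funD.
by exists (M + M') => x; rewrite (le_trans (ler_normD _ _))// lerD.
Qed.

Lemma bmfM f g : bmf f -> bmf g -> bmf (fun x => f x * g x).
Proof.
move=> [mf [M hM]] [mg [M' hM']]; split; first exact: measurable_funM.
by exists (M * M') => x; rewrite normrM ler_pM.
Qed.

Lemma bmfZ c f : bmf f -> bmf (fun x => c * f x).
Proof. exact/bmfM/bmf_cst. Qed.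

Lemma bmf_sum (K : Type) (s : seq K) (F : K -> R -> R) :
  (forall k, bmf (F k)) -> bmf (fun x => \sum_(k <- s) F k x).
Proof.
move=> bF; elim: s => [|k s ih].
  by under eq_fun do rewrite big_nil; exact: bmf_cst.
by under eq_fun do rewrite big_cons; exact: bmfD.
Qed.

Lemma bmf_cos t b : bmf (fun y => cos (t * y + b)).
Proof.
split; last by exists 1 => x; rewrite cos_max.
apply: (@measurableT_comp _ _ _ _ _ _ (@cos R)) => //.
  by apply: continuous_measurable_fun; exact: continuous_cos.
by apply: measurable_funD => //; apply: measurable_funM.
Qed.

Lemma bmf_sin t b : bmf (fun y => sin (t * y + b)).
Proof.
have -> : (fun y => sin (t * y + b)) = (fun y => cos (t * y + (b - pi / 2))).
  by apply/funext => y; rewrite addrA cosBpihalf.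
exact: bmf_cos.
Qed.

Lemma trig_bmf f : trig f -> bmf f.
Proof.
move=> [s sf]; have -> : f = (fun y => \sum_(p <- s) p.1.1 * cos (p.1.2 * y + p.2)).
  exact/funext.
by apply: bmf_sum => p; exact/bmfZ/bmf_cos.
Qed.

Lemma bmf_bool (p : R -> bool) : measurable [set y | p y] ->
  bmf (fun y => (p y)%:R).
Proof.
move=> mp; split; last by exists 1 => x; case: (p x); rewrite ?normr1 ?normr0.
have -> : (fun y => (p y)%:R) = \1_[set y | p y] :> (R -> R).
  apply/funext => y; rewrite indicE; congr (_%:R); congr nat_of_bool.
  by apply/idP/idP; rewrite ?inE.
exact: measurable_indic.
Qed.

Lemma bmf_le x : bmf (fun y => (y <= x)%R%:R).
Proof.
by apply: bmf_bool; rewrite (_ : [set y | _] = [set` `]-oo, x]]).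
Qed.

Lemma bmf_near a h : bmf (fun y => (`|y - a| <= h)%R%:R).
Proof.
apply: bmf_bool; rewrite (_ : [set y | _] = [set` `[a - h, a + h]]) //.
by apply/seteqP; split => y /=; rewrite in_itv/= ler_distl.
Qed.

Lemma bmf_far r : bmf (fun y => (r < `|y|)%R%:R).
Proof.
have -> : (fun y => (r < `|y|)%R%:R) = (fun y => 1 + -1 * (`|y - 0| <= r)%R%:R) :> (R -> R).
  by apply/funext => y; rewrite subr0 ltNge; case: (_ <= r) => /=; lra.
by apply: bmfD; [exact: bmf_cst|exact/bmfZ/bmf_near].
Qed.

Section posfun_lemmas.
Variables (I : (R -> R) -> R) (pI : posfun I).

Lemma pf_cst c : I (fun=> c) = c * I (fun=> 1).
Proof.
rewrite -(pfZ pI); last exact: bmf_cst.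
by congr I; apply/funext => y; rewrite mulr1.
Qed.

Lemma pf_ge0 f : bmf f -> (forall x, 0 <= f x) -> 0 <= I f.
Proof.
move=> bf f0; have <- : I (fun=> 0) = 0 by rewrite pf_cst mul0r.
by apply: (pf_le pI) => //; exact: bmf_cst.
Qed.

Lemma pf_sum (K : Type) (s : seq K) (F : K -> R -> R) :
  (forall k, bmf (F k)) ->
  I (fun x => \sum_(k <- s) F k x) = \sum_(k <- s) I (F k).
Proof.
move=> bF; elim: s => [|k s ih].
  by under eq_fun do rewrite big_nil; rewrite big_nil pf_cst mul0r.
under eq_fun do rewrite big_cons.
by rewrite big_cons (pfD pI) ?ih//; exact: bmf_sum.
Qed.

Lemma pf_cos t b : I (fun y => cos (t * y + b)) =
  cos b * I (fun y => cos (t * y)) - sin b * I (fun y => sin (t * y)).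
Proof.
have h1 : bmf (fun y => cos (t * y)).
  by have := bmf_cos t 0; under eq_fun do rewrite addr0.
have h2 : bmf (fun y => sin (t * y)).
  by have := bmf_sin t 0; under eq_fun do rewrite addr0.
rewrite -mulNr -!(pfZ pI)// -(pfD pI); [|exact: bmfZ..].
by congr I; apply/funext => y; rewrite cosD; ring.
Qed.

End posfun_lemmas.

Definition cf_dist I J t : R :=
  `|I (fun y => cos (t * y)) - J (fun y => cos (t * y))| +
  `|I (fun y => sin (t * y)) - J (fun y => sin (t * y))|.

(** A translation only changes the phases, so the bound does not depend on [a]; this is the source
    of the uniformity in x. *)
Lemma pf_trig_dist (I J : (R -> R) -> R) (s : seq (R * R * R)) f a :
  posfun I -> posfun J ->
  (forall y, f y = \sum_(p <- s) p.1.1 * cos (p.1.2 * y + p.2)) ->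
  `|I (fun y => f (y - a)) - J (fun y => f (y - a))| <=
  \sum_(p <- s) `|p.1.1| * cf_dist I J p.1.2.
Proof.
move=> pI pJ sf.
have E K : posfun K -> K (fun y => f (y - a)) =
  \sum_(p <- s) p.1.1 * K (fun y => cos (p.1.2 * y + (p.2 - p.1.2 * a))).
  move=> pK; rewrite -(@eq_bigr _ _ _ _ _ _ (fun p => K (fun y => p.1.1 * cos (p.1.2 * y + (p.2 - p.1.2 * a))))); last first.
    by move=> p _; rewrite (pfZ pK)//; exact: bmf_cos.
  rewrite -(pf_sum pK); last by move=> p; exact/bmfZ/bmf_cos.
  congr K; apply/funext => y; rewrite sf; apply: eq_bigr => p _.
  by congr (_ * cos _); ring.
rewrite !E// -sumrB (le_trans (ler_norm_sum _ _ _))//.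
apply: ler_sum => p _; rewrite -mulrBr normrM ler_wpM2l//.
rewrite (pf_cos pI) (pf_cos pJ) /cf_dist.
set b := p.2 - _.
set A := I _; set B := I _; set C := J _; set D := J _.
have -> : cos b * A - sin b * B - (cos b * C - sin b * D) =
  cos b * (A - C) - sin b * (B - D) by ring.
rewrite (le_trans (ler_normB _ _))// !normrM lerD//.
  by rewrite ler_piMl// cos_max.
by rewrite ler_piMl// sin_max.
Qed.

End positive_functionals.

(** * Comparison of distribution functions, tails and small balls *)

Section smoothing.
Variable R : realType.
Implicit Types (x y a b c t d e h r C L T : R) (f g : R -> R) (I J : (R -> R) -> R).

(* Both comparisons sandwich the indicator of (-oo, x] between translates of a
   trigonometric step function; the tails absorb the periodicity of the step. *)
Lemma cdf_dist_le I J (q : R -> R) e h r :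
  posfun I -> posfun J -> 0 < e -> 0 < h -> 0 <= r ->
  I (fun=> 1) <= 1 -> J (fun=> 1) <= 1 ->
  `|I (fun=> 1) - J (fun=> 1)| <= e ->
  I (fun y => (r < `|y|)%R%:R) <= e -> J (fun y => (r < `|y|)%R%:R) <= e ->
  (forall a, J (fun y => (`|y - a| <= h)%R%:R) <= e) ->
  bmf q -> (forall u, 0 <= q u <= 1) ->
  (forall u, - (2 * r + h) <= u <= - h -> 1 - e <= q u) ->
  (forall u, h <= u <= 2 * r + h -> q u <= e) ->
  (forall a, `|I (fun y => q (y - a)) - J (fun y => q (y - a))| <= e) ->
  forall x, `|I (fun y => (y <= x)%R%:R) - J (fun y => (y <= x)%R%:R)| <= 6 * e.
Proof.
move=> pI pJ e0 h0 r0 I1 J1 IJ1 Ir Jr Jh bq q01 qlo qhi IJq x.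
have bq' a : bmf (fun y => q (y - a)).
  case: bq => mq [M hM]; split; last by exists M.
  apply: (@measurableT_comp _ _ _ _ _ _ q) => //.
  exact: measurable_funB.
(* For |a| <= r + h and |y| <= r one has |y - a| <= 2r + h, inside the window where q is a good
   step; one e pays for the error of q and one for the tail. *)
have ub K a : posfun K -> K (fun=> 1) <= 1 -> K (fun y => (r < `|y|)%R%:R) <= e ->
    `|a| <= r + h ->
    K (fun y => (y <= a - h)%R%:R) <= K (fun y => q (y - a)) + 2 * e.
  move=> pK K1 Kr ar.
  apply: (@le_trans _ _ (K (fun y => q (y - a) + (e * 1 + (r < `|y|)%R%:R)))).
    apply: (pf_le pK); first exact: bmf_le.
      by apply: bmfD => //; apply: bmfD; [exact: bmf_cst|exact: bmf_far].
    move=> y; have /andP[q0 q1] := q01 (y - a).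
    case: (ltP r `|y|) => [|yr] /=; first by case: (y <= _) => /=; lra.
    case: (leP y (a - h)) => [ya|_] /=; last by lra.
    have : 1 - e <= q (y - a).
      by apply: qlo; move: ar yr; rewrite !ler_norml; lra.
    lra.
  rewrite (pfD pK)//; last by apply: bmfD; [exact: bmf_cst|exact: bmf_far].
  rewrite (pfD pK); [|exact: bmf_cst|exact: bmf_far].
  rewrite (pf_cst pK (e * 1)); nra.
have lb K a : posfun K -> K (fun=> 1) <= 1 -> K (fun y => (r < `|y|)%R%:R) <= e ->
    `|a| <= r + h ->
    K (fun y => q (y - a)) <= K (fun y => (y <= a + h)%R%:R) + 2 * e.
  move=> pK K1 Kr ar.
  apply: (@le_trans _ _ (K (fun y => (y <= a + h)%R%:R + (e * 1 + (r < `|y|)%R%:R)))).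
    apply: (pf_le pK) => //.
      by apply: bmfD; [exact: bmf_le|apply: bmfD; [exact: bmf_cst|exact: bmf_far]].
    move=> y; have /andP[q0 q1] := q01 (y - a).
    case: (ltP r `|y|) => [|yr] /=; first by case: (y <= _) => /=; lra.
    case: (leP y (a + h)) => [_|ya] /=; first by lra.
    have : q (y - a) <= e.
      by apply: qhi; move: ar yr; rewrite !ler_norml; lra.
    lra.
  rewrite (pfD pK); [|exact: bmf_le|by apply: bmfD; [exact: bmf_cst|exact: bmf_far]].
  rewrite (pfD pK); [|exact: bmf_cst|exact: bmf_far].
  rewrite (pf_cst pK (e * 1)); nra.
(* Sandwiching between translates of q overshoots x by 2h; only J is known to charge such an
   interval little, so the shift is always made on J. *)
have sb x' x'' : x'' = x' + 2 * h ->
    J (fun y => (y <= x'')%R%:R) <= J (fun y => (y <= x')%R%:R) + e.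
  move=> ->.
  apply: le_trans (_ : J (fun y => (y <= x')%R%:R + (`|y - (x' + h)| <= h)%R%:R) <= _).
    apply: (pf_le pJ); first exact: bmf_le.
      by apply: bmfD; [exact: bmf_le|exact: bmf_near].
    move=> y; case: (leP y (x' + 2 * h)) => [y1|_] /=; last by rewrite addr_ge0.
    case: (leP y x') => [_|y2] /=; first by rewrite lerDl.
    rewrite add0r; case: (leP `|y - _| h) => //.
    by rewrite lter_normr => /orP[] ?; lra.
  rewrite (pfD pJ); [|exact: bmf_le|exact: bmf_near].
  by rewrite lerD2l.
have small K : posfun K -> K (fun y => (r < `|y|)%R%:R) <= e -> x < - r ->
    0 <= K (fun y => (y <= x)%R%:R) <= e.
  move=> pK Kr xr; apply/andP; split.
    by apply: (pf_ge0 pK) => //; exact: bmf_le.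
  apply: le_trans Kr; apply: (pf_le pK); [exact: bmf_le|exact: bmf_far|].
  move=> y; case: (leP y x) => //= yx; case: (ltP r `|y|) => //=.
  by rewrite ler_norml; lra.
have large K : posfun K -> K (fun y => (r < `|y|)%R%:R) <= e -> r < x ->
    K (fun=> 1) - e <= K (fun y => (y <= x)%R%:R) <= K (fun=> 1).
  move=> pK Kr xr; apply/andP; split; last first.
    apply: (pf_le pK); [exact: bmf_le|exact: bmf_cst|].
    by move=> y; case: (y <= _).
  rewrite lerBlDr; apply: (@le_trans _ _ (K (fun y => (y <= x)%R%:R + (r < `|y|)%R%:R))).
    apply: (pf_le pK); [exact: bmf_cst|by apply: bmfD; [exact: bmf_le|exact: bmf_far]|].
    move=> y; case: (leP y x) => /= [_|yx]; first by rewrite lerDl.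
    case: (ltP r `|y|) => /=; rewrite ?add0r// ler_norml; lra.
  rewrite (pfD pK); [|exact: bmf_le|exact: bmf_far].
  by rewrite lerD2l.
have [xr|rx] := leP `|x| r; last first.
  move: rx; rewrite lter_normr => /orP[rx|rx].
    have /andP[? ?] := large I pI Ir rx; have /andP[? ?] := large J pJ Jr rx.
    by move: IJ1; rewrite !ler_norml; lra.
  have rx' : x < - r by lra.
  have /andP[? ?] := small I pI Ir rx'; have /andP[? ?] := small J pJ Jr rx'.
  by rewrite !ler_norml; lra.
have ax : `|x + h| <= r + h by move: xr; rewrite !ler_norml; lra.
have ax' : `|x - h| <= r + h by move: xr; rewrite !ler_norml; lra.
(* Six e in each chain: two for I against q, two for q against J, one for I against J on q, one for
   the shift. *)
have u1 := ub I (x + h) pI I1 Ir ax; rewrite addrK in u1.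
have u2 := lb J (x + h) pJ J1 Jr ax.
have u3 := sb x (x + h + h) ltac:(ring).
have u4 := IJq (x + h).
have v1 := lb I (x - h) pI I1 Ir ax'; rewrite subrK in v1.
have v2 := ub J (x - h) pJ J1 Jr ax'.
have v3 := sb (x - h - h) x ltac:(ring).
have v4 := IJq (x - h).
move: u4 v4; rewrite !ler_norml => /andP[? ?] /andP[? ?]; lra.
Qed.

(** A continuity theorem for two moving laws: the transforms merge pointwise, both sequences are
    tight, and uniformly small balls of [J n] replace the continuity of a fixed limit. *)
Lemma cdf_unif_cvg (I J : nat -> (R -> R) -> R) :
  (\forall n \near \oo, posfun (I n) /\ posfun (J n)) ->
  (\forall n \near \oo, I n (fun=> 1) <= 1 /\ J n (fun=> 1) <= 1) ->
  (forall t, cf_dist (I n) (J n) t @[n --> \oo] --> 0) ->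
  (forall e, 0 < e -> exists r, \forall n \near \oo,
     I n (fun y => (r < `|y|)%R%:R) <= e /\ J n (fun y => (r < `|y|)%R%:R) <= e) ->
  (forall e, 0 < e -> exists2 h : R, 0 < h & \forall n \near \oo,
     forall a, J n (fun y => (`|y - a| <= h)%R%:R) <= e) ->
  forall e, 0 < e -> \forall n \near \oo, forall x,
    `|I n (fun y => (y <= x)%R%:R) - J n (fun y => (y <= x)%R%:R)| <= e.
Proof.
move=> pIJ IJ1 cvIJ tight smooth e e0.
have e60 : 0 < e / 6 by rewrite divr_gt0.
have [r hr] := tight _ e60; have [h h0 hh] := smooth _ e60.
pose r' := Num.max r 0.
have r'0 : 0 <= r' by rewrite le_max lexx orbT.
have L0 : 0 < 2 * r' + h by rewrite ltr_wpDl// mulr_ge0.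
have [q [tq q01 qlo qhi]] := trig_step h0 L0 e60.
have [s sq] := tq.
have cvs : \sum_(p <- s) `|p.1.1| * cf_dist (I n) (J n) p.1.2 @[n --> \oo] --> 0.
  elim: (s) => [|p s' ih].
    by under eq_fun do rewrite big_nil; exact: cvg_cst.
  under eq_fun do rewrite big_cons.
  have h1 : `|p.1.1| * cf_dist (I n) (J n) p.1.2 @[n --> \oo] --> `|p.1.1| * 0.
    by apply: cvgM => //; exact: cvg_cst.
  suff : `|p.1.1| * cf_dist (I n) (J n) p.1.2 +
      \sum_(j <- s') `|j.1.1| * cf_dist (I n) (J n) j.1.2 @[n --> \oo] -->
      `|p.1.1| * 0 + 0 by rewrite mulr0 addr0.
  exact: cvgD.
have {}cvs : \forall n \near \oo,
    \sum_(p <- s) `|p.1.1| * cf_dist (I n) (J n) p.1.2 <= e / 6.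
  move/cvgrPdist_le : cvs => /(_ _ e60); apply: filterS => n.
  by rewrite sub0r normrN; apply: le_trans; exact: ler_norm.
have cv1 : \forall n \near \oo, cf_dist (I n) (J n) 0 <= e / 6.
  move/cvgrPdist_le : (cvIJ 0) => /(_ _ e60); apply: filterS => n.
  by rewrite sub0r normrN; apply: le_trans; exact: ler_norm.
near=> n => x.
have [pI pJ] : posfun (I n) /\ posfun (J n) by near: n.
have [I1 J1] : I n (fun=> 1) <= 1 /\ J n (fun=> 1) <= 1 by near: n.
have [Ir Jr] : I n (fun y => (r < `|y|)%R%:R) <= e / 6 /\
    J n (fun y => (r < `|y|)%R%:R) <= e / 6 by near: n.
have far_r' K : posfun K -> K (fun y => (r < `|y|)%R%:R) <= e / 6 ->
    K (fun y => (r' < `|y|)%R%:R) <= e / 6.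
  move=> pK; apply: le_trans; apply: (pf_le pK); [exact: bmf_far..|].
  move=> y; case: (ltP r' `|y|) => //= h1.
  by rewrite (_ : _ < _)// (le_lt_trans _ h1)// le_max lexx.
have := @cdf_dist_le (I n) (J n) q (e / 6) h r' pI pJ e60 h0 r'0 I1 J1.
have -> : 6 * (e / 6) = e by field.
apply => //.
(* The transform at t = 0 compares the total masses, which may be less than 1. *)
- have : cf_dist (I n) (J n) 0 <= e / 6 by near: n.
  rewrite /cf_dist.
  under [X in I n X]eq_fun do rewrite mul0r cos0.
  under [X in J n X]eq_fun do rewrite mul0r cos0.
  by apply: le_trans; rewrite lerDl.
- exact: far_r'.
- exact: far_r'.
- by near: n.
- exact: trig_bmf.
- move=> a; apply: (le_trans (pf_trig_dist a pI pJ sq)).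
  by near: n.
Unshelve. all: by end_near.
Qed.

(** Chebyshev's inequality read off the transform: 1 - cos(t (y - c)) behaves as t^2 (y - c)^2 / 2
    at small t, so C plays the role of a variance up to a factor. The last hypothesis only lets t be
    so small that periodicity is invisible; its N does not enter the bound. *)
Lemma tail_le I C c r :
  posfun I -> 0 < r -> 0 <= C ->
  (forall t, 0 < t <= 1 -> I (fun y => 1 - cos (t * y - t * c)) <= C * t ^+ 2) ->
  (forall e, 0 < e -> exists N, I (fun y => (N < `|y|)%R%:R) <= e) ->
  I (fun y => (r + `|c| < `|y|)%R%:R) <= 4 * C / r ^+ 2.
Proof.
move=> pI r0 C0 Ht Hinf; apply/ler_addgt0Pr => e e0.
have [N hN] := Hinf _ e0.
pose M := Num.max 1 (N + `|c|).
have M1 : 1 <= M by rewrite le_max lexx.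
have M0 : 0 < M by lra.
have MN : N + `|c| <= M by rewrite le_max lexx orbT.
have t01 : 0 < M^-1 <= 1 by rewrite invr_gt0 M0/= invf_le1.
have /andP[t0 t1] := t01.
have bc : bmf (fun y => 1 - cos (M^-1 * y - M^-1 * c)).
  have -> : (fun y => 1 - cos (M^-1 * y - M^-1 * c)) =
    (fun y => 1 + -1 * cos (M^-1 * y + - (M^-1 * c))).
    by apply/funext => y; rewrite mulN1r.
  by apply: bmfD; [exact: bmf_cst|exact/bmfZ/bmf_cos].
(* At t = 1/M, 1 - cos (t (y - c)) is at least quadratic on the whole of [-N, N]. *)
pose k := 4 / (M^-1 * r) ^+ 2.
have k0 : 0 < k by rewrite divr_gt0// exprn_gt0// mulr_gt0.
apply: (@le_trans _ _ (I (fun y => k * (1 - cos (M^-1 * y - M^-1 * c)) + (N < `|y|)%R%:R))).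
  apply: (pf_le pI); [exact: bmf_far|apply: bmfD; [exact: bmfZ|exact: bmf_far]|].
  move=> y.
  have h0 : 0 <= k * (1 - cos (M^-1 * y - M^-1 * c)).
    by rewrite mulr_ge0 ?(ltW k0)// subr_ge0 cos_le1.
  case: (ltP N `|y|) => [_|yN] /=.
    by case: (_ < `|y|) => /=; lra.
  case: ltP => /= [ry|_]; last by lra.
  rewrite addr0 mulrC -ler_pdivrMr// div1r /k invf_div.
  have yc : `|y - c| <= M.
    by rewrite (le_trans (ler_normB _ _))//; lra.
  have : `|M^-1 * (y - c)| <= 1.
    by rewrite normrM (ger0_norm (ltW t0)) mulrC ler_pdivrMr// mul1r.
  move=> /cos_le_quad; rewrite -mulrBr => hc.
  have rc : r <= `|y - c| by have := lerB_normD y (- c); rewrite normrN; lra.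
  have : (M^-1 * r) ^+ 2 <= (M^-1 * (y - c)) ^+ 2.
    rewrite !exprMn ler_pM2l ?exprn_gt0// -[leRHS]real_normK ?num_real//.
    by rewrite lerXn2r ?nnegrE// ltW.
  lra.
rewrite (pfD pI) ?(pfZ pI)//; [|exact: bmfZ|exact: bmf_far].
apply: lerD => //.
apply: (le_trans (ler_wpM2l (ltW k0) (Ht _ t01))).
rewrite /k le_eqVlt; apply/orP; left; apply/eqP; field.
by rewrite (gt_eqF r0) (gt_eqF M0).
Qed.

(** On the ball the arguments k T (y - a) are at most 1 in modulus, so C >= N/2 and 4 (C^2 + S^2) /
    N^2 >= 1. In the double sum the N diagonal terms have integral at most 1, the others have
    frequency at least T and integral at most b; the bound is 4/N^2 times N (1 + N b). *)
Lemma small_ball_le J T b N h a :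
  posfun J -> J (fun=> 1) <= 1 -> (0 < N)%N -> 0 < T -> 0 <= b ->
  (forall t, T <= `|t| ->
    `|J (fun y => cos (t * y))| + `|J (fun y => sin (t * y))| <= b) ->
  N%:R * T * h <= 1 ->
  J (fun y => (`|y - a| <= h)%R%:R) <= 4 / N%:R + 4 * b.
Proof.
move=> pJ J1 N0 T0 b0 Hb NTh.
have N0' : 0 < N%:R :> R by rewrite ltr0n.
(* [C ^+ 2 + S ^+ 2] is N times a Fejer kernel centred at a. *)
pose C y : R := \sum_(k < N) cos (k%:R * T * (y - a)).
pose S y : R := \sum_(k < N) sin (k%:R * T * (y - a)).
have FE y : C y ^+ 2 + S y ^+ 2 =
    \sum_(k < N) \sum_(l < N) cos (((k%:R - l%:R) * T) * y + - (((k%:R - l%:R) * T) * a)).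
  rewrite /C /S !expr2 !big_distrlr/= -big_split/=; apply: eq_bigr => k _.
  rewrite -big_split/=; apply: eq_bigr => l _; rewrite -cosB.
  by congr cos; ring.
have bF : bmf (fun y => C y ^+ 2 + S y ^+ 2).
  rewrite (funext FE); apply: bmf_sum => k; apply: bmf_sum => l.
  exact: bmf_cos.
apply: (@le_trans _ _ (J (fun y => 4 / N%:R ^+ 2 * (C y ^+ 2 + S y ^+ 2)))).
  apply: (pf_le pJ); [exact: bmf_near|exact: bmfZ|].
  move=> y; case: (leP `|y - a| h) => /= [yh|_]; last first.
    apply: mulr_ge0; first by rewrite divr_ge0// exprn_ge0.
    by rewrite addr_ge0// sqr_ge0.
  rewrite mulrC -ler_pdivrMr ?divr_gt0 ?exprn_gt0// div1r invf_div.
  have CN : N%:R / 2 <= C y.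
    apply: (@le_trans _ _ (\sum_(k < N) 2^-1)).
      by rewrite sumr_const card_ord -[leRHS]mulr_natl.
    apply: ler_sum => k _.
    have : `|k%:R * T * (y - a)| <= 1.
      rewrite !normrM (ger0_norm (ltW T0)) ger0_norm//.
      apply: le_trans NTh; apply: ler_pM => //.
        by rewrite mulr_ge0// ltW.
      by rewrite ler_wpM2r ?(ltW T0)// ler_nat ltnW.
    move=> h1; have := cos_ge_quad (k%:R * T * (y - a)).
    have : (k%:R * T * (y - a)) ^+ 2 <= 1.
      by rewrite -real_normK ?num_real// exprn_ile1.
    lra.
  have : (N%:R / 2) ^+ 2 <= C y ^+ 2 by rewrite lerXn2r ?nnegrE//; lra.
  have := sqr_ge0 (S y); rewrite expr_div_n; lra.
rewrite (pfZ pJ)// (funext FE) (pf_sum pJ); last first.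
  by move=> k; apply: bmf_sum => l; exact: bmf_cos.
have : \sum_(k < N) J (fun x => \sum_(l < N)
    cos ((k%:R - l%:R) * T * x + - ((k%:R - l%:R) * T * a))) <=
    \sum_(k < N) (1 + N%:R * b).
  apply: ler_sum => k _; rewrite (pf_sum pJ); last by move=> l; exact: bmf_cos.
  rewrite (bigD1 k)//= lerD//.
    rewrite subrr !mul0r oppr0; under eq_fun do rewrite mul0r addr0 cos0.
    exact: J1.
  apply: (@le_trans _ _ (\sum_(l < N | l != k) b)).
    apply: ler_sum => l lk.
    set t := (_ - _) * T.
    have Tt : T <= `|t|.
      rewrite /t normrM (ger0_norm (ltW T0)) ler_peMl ?(ltW T0)//.
      rewrite -[X in X - _]/(k%:Z%:~R) -[X in _ - X]/(l%:Z%:~R) -intrB -intr_norm.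
      by rewrite ler1z -gtz0_ge1 normr_gt0 subr_eq0 eqz_nat eq_sym.
    rewrite (pf_cos pJ) (le_trans _ (Hb _ Tt))// (le_trans (ler_norm _))//.
    rewrite (le_trans (ler_normB _ _))// !normrM lerD//.
      by rewrite ler_piMl// cos_max.
    by rewrite ler_piMl// sin_max.
  rewrite sumr_const -[leLHS]mulr_natl ler_wpM2r// ler_nat.
  by rewrite (leq_trans (max_card _))// card_ord.
rewrite sumr_const card_ord -[X in _ <= X]mulr_natl => h1.
apply: (le_trans (ler_wpM2l _ h1)); first by rewrite divr_ge0// exprn_ge0.
rewrite le_eqVlt; apply/orP; left; apply/eqP; field.
by rewrite (gt_eqF N0').
Qed.

End smoothing.

(** * The Levy measure of W *)

Section log2_facts.
Variable R : realType.
Implicit Types x y z : R.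

Lemma ln2_gt0 : 0 < ln 2 :> R.
Proof. by apply: ln_gt0; rewrite ltr1n. Qed.

Lemma pow2z_gt0 (m : int) : 0 < (2 : R) ^ m.
Proof. exact: exprz_gt0. Qed.

Lemma pow2z_subn (m : int) (k : nat) : (2 : R) ^ (m - k%:Z) = 2 ^ m / 2 ^+ k.
Proof. by rewrite expfzDr ?pnatr_eq0// -invr_expz. Qed.

Lemma pow2negE (m : int) : pow2neg R m = (2 ^ m)^-1.
Proof. by rewrite /pow2neg invr_expz. Qed.

Lemma ln_pow2z (m : int) : ln ((2 : R) ^ m) = m%:~R * ln 2.
Proof. by rewrite -powR_intmul// ln_powR. Qed.

Lemma log2_pow2z (m : int) : log2 ((2 : R) ^ m) = m%:~R.
Proof. by rewrite /log2 ln_pow2z mulfK// gt_eqF// ln2_gt0. Qed.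

Lemma log2M x y : 0 < x -> 0 < y -> log2 (x * y) = log2 x + log2 y.
Proof. by move=> x0 y0; rewrite /log2 lnM ?posrE// mulrDl. Qed.

Lemma ler_log2 x y : 0 < x -> x <= y -> log2 x <= log2 y.
Proof.
move=> x0 xy; rewrite /log2 ler_pM2r ?invr_gt0 ?ln2_gt0// ler_ln// posrE//.
exact: lt_le_trans xy.
Qed.

Lemma ltr_log2 x y : 0 < x -> x < y -> log2 x < log2 y.
Proof.
move=> x0 xy; rewrite /log2 ltr_pM2r ?invr_gt0 ?ln2_gt0// ltr_ln// posrE//.
exact: lt_trans xy.
Qed.

Lemma powR_log2 x : 0 < x -> 2 `^ log2 x = x.
Proof.
move=> x0; rewrite /powR pnatr_eq0/= /log2 divfK ?gt_eqF ?ln2_gt0//.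
by rewrite lnK.
Qed.

Lemma powR_frac_log2 z (m : int) : (2 : R) ^ m <= z -> z < (2 : R) ^ (m + 1) ->
  2 `^ Defs.frac (log2 z) = z / (2 : R) ^ m.
Proof.
move=> zm zm1.
have z0 : 0 < z by rewrite (lt_le_trans _ zm) ?pow2z_gt0.
have fl : Num.floor (log2 z) = m.
  apply: floor_def; rewrite -!log2_pow2z ler_log2 ?pow2z_gt0//=.
  exact: ltr_log2.
by rewrite /Defs.frac fl powRB ?pnatr_eq0 ?implybT// powR_log2// powR_intmul.
Qed.

End log2_facts.

Section levy_measure.
Variables (R : realType) (j : int) (g : R).
Hypothesis g0 : 0 < g.
Let a := g * pow2neg R j.

Let a0 : 0 < a. Proof. by rewrite mulr_gt0// pow2z_gt0. Qed.

Definition atom (b : R) (k : nat) : R := (b * 2 ^+ k)^-1.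

Let x_ := atom a.

Lemma atom_gt0 b k : 0 < b -> 0 < atom b k.
Proof. by move=> b0; rewrite invr_gt0 mulr_gt0// exprn_gt0. Qed.

Lemma atomS b k : 0 < b -> atom b k.+1 < atom b k.
Proof.
move=> b0; rewrite ltf_pV2 ?posrE ?mulr_gt0 ?exprn_gt0//.
by rewrite ltr_pM2l// ltr_eXn2l ?ltr1n.
Qed.

Lemma atom_le b m n : 0 < b -> (m <= n)%N -> atom b n <= atom b m.
Proof.
move=> b0; elim: n => [|n ih]; first by rewrite leqn0 => /eqP ->.
rewrite leq_eqVlt => /orP[/eqP -> //|/ih]; apply: le_trans.
exact/ltW/atomS.
Qed.

Lemma atom0E : x_ 0 = (2 : R) ^ j / g.
Proof. by rewrite /x_ /atom expr0 mulr1 /a /pow2neg invfM invr_expz opprK mulrC. Qed.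

Lemma L_jg_large x : x_ 0 <= x -> L_jg j g x = 0.
Proof. by rewrite atom0E /L_jg => h; rewrite ltNge h. Qed.

(** The power 2^frac(log2(g x)) is g x over a power of 2 that is fixed on the block, so x cancels
    and L is a step function. *)
Lemma L_jg_small k x : x_ k.+1 <= x -> x < x_ k -> L_jg j g x = a - a * 2 ^+ k.+1.
Proof.
move=> kx xk.
have x0 : 0 < x by rewrite (lt_le_trans _ kx)// atom_gt0.
have xE i : x_ i = (2 : R) ^ (j - i%:Z) / g.
  rewrite /x_ /atom /a /pow2neg !invfM invr_expz opprK expfzDr ?pnatr_eq0//.
  by rewrite -invr_expz -exprnP; ring.
have x_le i : x_ i <= x_ 0 by exact: atom_le.
rewrite /L_jg -atom0E (lt_le_trans xk)//.
rewrite (@powR_frac_log2 _ _ (j - k.+1%:Z)).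
- rewrite /a -/(pow2neg R j); congr (_ - _).
  rewrite pow2negE pow2z_subn; field.
  by rewrite !gt_eqF ?pow2z_gt0 ?exprn_gt0.
- by move: kx; rewrite xE ler_pdivrMr// mulrC.
- move: xk; rewrite xE ltr_pdivlMr// mulrC; congr (_ < _ ^ _).
  by rewrite -addn1 PoszD; ring.
Qed.

Variable nu : {measure set R -> \bar R}.
Hypothesis Lnu : is_levy_measure_of (L_jg j g) nu.

Let piece k : set R := [set` `]x_ k.+1, x_ k]].

Lemma levy_piece k : nu (piece k) = (a * 2 ^+ k)%:E.
Proof.
rewrite /piece Lnu ?atom_gt0//; last exact/ltW/atomS.
congr (_%:E); rewrite (@L_jg_small k (x_ k.+1)) ?atomS// exprS.
case: k => [|k]; first by rewrite L_jg_large// expr0; ring.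
by rewrite (@L_jg_small k (x_ k.+1)) ?atomS// exprS; ring.
Qed.

(** [nu] is prescribed only on half-open intervals, so the open gap is exhausted by intervals closed
    on the right, where L has no increment; the mass of a piece thus sits at its right end. *)
Lemma levy_gap k : nu [set` `]x_ k.+1, x_ k[] = 0%E.
Proof.
pose d := x_ k - x_ k.+1.
have d0 : 0 < d by rewrite subr_gt0 atomS.
have -> : [set` `]x_ k.+1, x_ k[] =
    \bigcup_n [set` `]x_ k.+1, x_ k - d / n.+1%:R]] :> set R.
  apply/seteqP; split => [x /=|x [n _] /=]; rewrite !in_itv/=.
    move=> /andP[x1 x2].
    have [n hn] : exists n : nat, d / (x_ k - x) <= n.+1%:R.
      exists (Num.bound (d / (x_ k - x))); apply/ltW.
      have := archi_boundP (_ : 0 <= d / (x_ k - x)).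
      rewrite divr_ge0 ?(ltW d0) ?subr_ge0 ?(ltW x2)// => /(_ isT) /lt_le_trans; apply.
      by rewrite ler_nat.
    exists n => //=; rewrite in_itv/= x1/= lerBrDr -lerBrDl.
    rewrite ler_pdivrMr// mulrC -ler_pdivrMr// subr_gt0//.
  move=> /andP[-> xn]; rewrite (le_lt_trans xn)// ltrBlDr ltrDl divr_gt0//.
apply/negligibleP; first by apply: bigcup_measurable => n _.
apply: negligible_bigcup => n; apply/negligibleP => //.
have [h|h] := leP (x_ k.+1) (x_ k - d / n.+1%:R); last first.
  by rewrite set_itv_ge ?measure0// bnd_simp -leNgt ltW.
transitivity (L_jg j g (x_ k - d / n.+1%:R) - L_jg j g (x_ k.+1))%:E.
  by apply: Lnu => //; exact: atom_gt0.
rewrite (@L_jg_small k (_ - _))//; last by rewrite ltrBlDr ltrDl divr_gt0.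
by rewrite (@L_jg_small k (x_ k.+1)) ?atomS// subrr.
Qed.

Lemma levy_above : nu [set` `]x_ 0, +oo[] = 0%E.
Proof.
have -> : [set` `]x_ 0, +oo[] = \bigcup_n [set` `]x_ 0, x_ 0 + n%:R]] :> set R.
  apply/seteqP; split => [x /=|x [n _] /=]; rewrite !in_itv/=; last by case/andP => ->.
  rewrite andbT => x1; exists (Num.bound (x - x_ 0)) => //=; rewrite in_itv/= x1/=.
  rewrite -lerBlDl; apply/ltW/archi_boundP; rewrite subr_ge0; exact: ltW.
apply/negligibleP; first by apply: bigcup_measurable => n _.
apply: negligible_bigcup => n; apply/negligibleP => //.
transitivity (L_jg j g (x_ 0 + n%:R) - L_jg j g (x_ 0))%:E.
  by apply: Lnu; [exact: atom_gt0|rewrite lerDl].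
by rewrite !L_jg_large// ?subrr// lerDl.
Qed.

Lemma levy_ge0_integral (f : R -> R) : measurable_fun setT f ->
  (forall x, 0 < x -> 0 <= f x) ->
  (\int[nu]_(x in [set` `]0%R, +oo[]) (f x)%:E =
   \sum_(k <oo) (a * 2 ^+ k * f (x_ k))%:E)%E.
Proof.
move=> mf f0.
have ppos k x : piece k x -> 0 < x.
  by rewrite /piece/= in_itv/= => /andP[h _]; rewrite (lt_trans _ h)// atom_gt0.
have x_le m n : (m <= n)%N -> x_ n <= x_ m by exact: atom_le.
have -> : [set` `]0, +oo[] = (\bigcup_k piece k) `|` [set` `]x_ 0, +oo[] :> set R.
  apply/seteqP; split => [x /=|x /= [[k _ /ppos]|]]; rewrite ?in_itv/= ?andbT//; last first.
    by apply: lt_trans; exact: atom_gt0.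
  move=> x0; have [h|h] := ltP (x_ 0) x; [by right|left].
  have ex : exists n, x_ n < x.
    have xa0 : 0 < x * a := mulr_gt0 x0 a0.
    exists (Num.bound (x * a)^-1); rewrite /x_ /atom.
    have p0 n : 0 < a * 2 ^+ n by apply: mulr_gt0 => //; exact: exprn_gt0.
    rewrite -[ltLHS]mul1r ltr_pdivrMr// mulrA -ltr_pdivrMl// mulr1.
    apply: (lt_trans (archi_boundP (_ : 0 <= (x * a)^-1))).
      by rewrite invr_ge0 ltW.
    by rewrite -natrX ltr_nat ltn_expl.
  have := ex_minnP ex => -[[|n] xn nmin]; first by rewrite ltNge h in xn.
  exists n => //; rewrite /piece/= in_itv/= xn/= leNgt; apply/negP => /nmin.
  by rewrite ltnn.
have mfE (D : set R) : measurable_fun D (EFin \o f).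
  by apply/measurable_EFinP; exact: measurable_funS mf.
have mp k : measurable (piece k) by exact: measurable_itv.
have mup : measurable (\bigcup_k piece k) by exact: bigcup_measurable.
rewrite ge0_integral_setU//=; last 2 first.
- move=> x /= [[k _ /ppos]|]; first by rewrite lee_fin => /f0.
  rewrite in_itv/= andbT => h; rewrite lee_fin f0// (lt_trans _ h)//; exact: atom_gt0.
- apply/disj_setPS => x [[k _]]; rewrite /piece/= !in_itv/= => /andP[_ h1].
  by rewrite andbT ltNge (le_trans h1)// x_le.
rewrite [X in (_ + X)%E](null_set_integral _ _ levy_above)//.
rewrite adde0 ge0_integral_bigcup//; last 2 first.
- by move=> x [k _ /ppos/f0]; rewrite lee_fin.
- apply/trivIsetP => i k _ _; wlog ik : i k / (i < k)%N => [H|].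
    rewrite neq_ltn => /orP[ik|ki]; first by apply: H => //; rewrite neq_ltn ik.
    by rewrite setIC; apply: H => //; rewrite neq_ltn ki.
  move=> _; rewrite -subset0 => x; rewrite /piece/= !in_itv/= => -[/andP[h1 _] /andP[_ h2]].
  by have := lt_le_trans h1 h2; rewrite ltNge x_le.
apply: eq_eseriesr => k _.
(* Off the null gap a piece reduces to its right end, so f may be replaced by its value there. *)
rewrite (@ge0_ae_eq_integral _ _ _ nu (piece k) _ (cst (f (x_ k))%:E))//.
- rewrite integral_cst//= levy_piece -EFinM; congr (_%:E); exact: mulrC.
- by move=> x /ppos/f0; rewrite lee_fin.
- by move=> x _; rewrite lee_fin f0// atom_gt0.
- exists [set` `]x_ k.+1, x_ k[]; split => //; first exact: levy_gap.
  move=> x /=; rewrite /piece/= => /not_implyP[].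
  rewrite !in_itv/= => /andP[-> h1] h2; rewrite lt_neqAle h1 andbT.
  by apply/negP => /eqP xk; apply: h2; rewrite xk.
Qed.

(** [Rintegral] takes [fine] of the integral, so finiteness is needed before it is the limit of the
    partial sums: the quadratic bound dominates the k-th term by (C/a) 2^(-k). *)
Lemma levy_cvg_Rintegral (f : R -> R) C : measurable_fun setT f -> 0 <= C ->
  (forall x, 0 < x -> 0 <= f x <= C * x ^+ 2) ->
  \sum_(k < n) a * 2 ^+ k * f (x_ k) @[n --> \oo] -->
    Rintegral nu [set` `]0, +oo[] f.
Proof.
move=> mf C0 fC.
have f0 x : 0 < x -> 0 <= f x by move=> /fC /andP[].
rewrite /Rintegral levy_ge0_integral//.
have c0 k : (0 <= (a * 2 ^+ k * f (x_ k))%:E)%E.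
  by rewrite lee_fin mulr_ge0 ?f0 ?atom_gt0// mulr_ge0 ?(ltW a0)// exprn_ge0.
have cvS := is_cvg_nneseries (fun n _ _ => c0 n) (P := xpredT).
have bnd : (\sum_(k <oo) (a * 2 ^+ k * f (x_ k))%:E <= (2 * C / a)%:E)%E.
  apply: lime_le => //; near=> n.
  rewrite big_mkord sumEFin lee_fin.
  apply: (@le_trans _ _ (\sum_(k < n) C / a * (1 / 2) ^+ k)).
    apply: ler_sum => k _; have /andP[_ h] := fC _ (atom_gt0 k a0).
    have h2 : 0 <= a * 2 ^+ k by rewrite mulr_ge0 ?(ltW a0)// exprn_ge0.
    apply: (le_trans (ler_wpM2l h2 h)).
    rewrite le_eqVlt; apply/orP; left; apply/eqP.
    rewrite /x_ /atom expr_div_n expr1n.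
    by field; rewrite (gt_eqF a0)/= expf_neq0.
  have -> : 2 * C / a = C / a * 2 by ring.
  rewrite -mulr_sumr; apply: ler_wpM2l; first by rewrite divr_ge0 ?(ltW a0).
  have -> : \sum_(k < n) (1 / 2 : R) ^+ k = 2 * (1 - (1 / 2) ^+ n).
    by rewrite -[X in _ = _ * X]opprB subrX1; field.
  have : 0 <= (1 / 2 : R) ^+ n by rewrite exprn_ge0.
  lra.
have fin : (\sum_(k <oo) (a * 2 ^+ k * f (x_ k))%:E)%E \is a fin_num.
  rewrite ge0_fin_numE; first by rewrite (le_lt_trans bnd) ?ltry.
  by apply: nneseries_ge0 => n _ _; exact: c0.
have : (\sum_(k < n) a * 2 ^+ k * f (x_ k))%:E @[n --> \oo] -->
    (fine (\sum_(k <oo) (a * 2 ^+ k * f (x_ k))%:E)%E)%:E.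
  rewrite fineK//; apply: cvg_trans (cvS 0%N); apply: near_eq_cvg; near=> n.
  by rewrite big_mkord sumEFin.
by move/fine_cvg; exact.
Unshelve. all: by end_near.
Qed.

End levy_measure.

(** * The characteristic function of W as a limit of sums over atoms *)

Section cf_of_W.
Variable R : realType.

(* Real and imaginary parts of b (exp(i t / b) - 1 - i t / b), b = a 2^k, which is the
   contribution of the k-th atom of the Levy measure. *)
Definition cf_re (a t : R) (k : nat) : R :=
  a * 2 ^+ k * (cos (t / (a * 2 ^+ k)) - 1).
Definition cf_im (a t : R) (k : nat) : R :=
  a * 2 ^+ k * (sin (t / (a * 2 ^+ k)) - t / (a * 2 ^+ k)).

(** Only a = g 2^(-j) matters: the drift j - log2 g is -log2 a and the atoms are 1/(a 2^k). All
    later estimates depend on this one parameter. *)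
Lemma is_df_W_cf (j : int) (g : R) (G : R -> R) : 0 < g -> is_df_W j g G ->
  exists mu : probability R R,
    (forall x, G x = fine (mu [set` `]-oo, x]])) /\
    forall t, exists A B : R,
      [/\ \sum_(k < n) cf_re (g * pow2neg R j) t k @[n --> \oo] --> A,
          \sum_(k < n) cf_im (g * pow2neg R j) t k @[n --> \oo] --> B,
          Rintegral mu setT (fun x => cos (t * x)) =
            expR A * cos (t * - log2 (g * pow2neg R j) + B) &
          Rintegral mu setT (fun x => sin (t * x)) =
            expR A * sin (t * - log2 (g * pow2neg R j) + B)].
Proof.
move=> g0 [mu [nu [Lnu [GE cfE]]]]; exists mu; split => // t.
have uE : u_jg j g = - log2 (g * pow2neg R j).
  rewrite /u_jg log2M ?pow2z_gt0// /pow2neg log2_pow2z.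
  by rewrite rmorphN/=; ring.
have [] := cfE t; rewrite uE.
set A := Rintegral nu _ (fun x => cos _ - _); set B := Rintegral nu _ _ => cE sE.
set a := g * _ in uE cE sE *.
have a0 : 0 < a by rewrite mulr_gt0// pow2z_gt0.
have mtx : measurable_fun setT (fun x : R => t * x).
  by apply: measurable_funM.
have mcos : measurable_fun setT (fun x : R => cos (t * x)).
  apply: (@measurableT_comp _ _ _ _ _ _ (@cos R)) => //.
  by apply: continuous_measurable_fun; exact: continuous_cos.
have msin : measurable_fun setT (fun x : R => sin (t * x)).
  apply: (@measurableT_comp _ _ _ _ _ _ (@sin R)) => //.
  by apply: continuous_measurable_fun; exact: continuous_sin.
(* The sums over atoms were obtained for nonnegative integrands, whereas cos - 1 is nonpositive. *)
have flip (f : R -> R) : measurable_fun setT f ->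
    (forall x, 0 < x -> - (t ^+ 2 / 2) * x ^+ 2 <= f x <= 0) ->
    \sum_(k < n) a * 2 ^+ k * f (atom a k) @[n --> \oo] -->
      Rintegral nu [set` `]0, +oo[] f.
  move=> mf f0.
  have mNf : measurable_fun setT (fun x => - f x) by exact: measurable_funN.
  have h : forall x, 0 < x -> 0 <= - f x <= t ^+ 2 / 2 * x ^+ 2.
    by move=> x /f0; lra.
  have := levy_cvg_Rintegral g0 Lnu mNf (_ : 0 <= t ^+ 2 / 2) h.
  rewrite divr_ge0 ?sqr_ge0// => /(_ isT) /cvgN.
  have -> : - Rintegral nu [set` `]0, +oo[] (fun x => - f x) = Rintegral nu [set` `]0, +oo[] f.
    rewrite /Rintegral; under eq_integral do rewrite EFinN.
    rewrite -fineN -integral_ge0N; last first.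
      by move=> x /=; rewrite in_itv/= andbT => /h /andP[+ _]; rewrite lee_fin.
    by congr fine; apply: eq_integral => x _; rewrite /= opprK.
  apply: cvg_trans; apply: near_eq_cvg; near=> n.
  rewrite -[LHS]/(- (\sum_(k < n) a * 2 ^+ k * - f (atom a k))) -sumrN.
  by apply: eq_bigr => k _; ring.
have tx2 (x : R) : (t * x) ^+ 2 / 2 = t ^+ 2 / 2 * x ^+ 2.
  by rewrite exprMn; ring.
exists A, B; split => //.
- apply: flip; first by apply: measurable_funB.
  move=> x x0; have := norm_cos_sub1 (t * x); rewrite ler_norml tx2.
  by have := cos_le1 (t * x); lra.
(* For x > 0, sin(t x) - t x has the sign opposite to that of t. *)
- have [t0|t0] := leP 0 t.
    apply: flip; first by apply: measurable_funB.
    move=> x x0; have := norm_sin_subr (t * x); rewrite ler_norml tx2.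
    have := sin_le (mulr_ge0 t0 (ltW x0)); lra.
  apply: (levy_cvg_Rintegral g0 Lnu (_ : measurable_fun setT _) (_ : 0 <= t ^+ 2 / 2)).
  + by apply: measurable_funB.
  + by rewrite divr_ge0 ?sqr_ge0.
  + move=> x x0; have := norm_sin_subr (t * x); rewrite ler_norml tx2.
    have : 0 <= - t * x by rewrite mulr_ge0 ?oppr_ge0 ?ltW.
    by move=> /sin_le; rewrite mulNr sinN; lra.
Unshelve. all: by end_near.
Qed.

End cf_of_W.

Section geometric_bound.
Variable R : realType.

Lemma geometric_series_cvg_bound (u : nat -> R) (c l : R) n :
  (forall k, `|u k| <= c * (1 / 2) ^+ k) ->
  \sum_(k < n) u k @[n --> \oo] --> l ->
  `|\sum_(k < n) u k - l| <= 2 * c * (1 / 2) ^+ n.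
Proof.
move=> uc ul.
have h : `|\sum_(k < n) u k - \sum_(k < m) u k| @[m --> \oo] -->
    `|\sum_(k < n) u k - l|.
  by apply: cvg_norm; apply: cvgB => //; exact: cvg_cst.
have c0 : 0 <= c.
  by have := uc 0%N; rewrite expr0 mulr1; apply: le_trans; exact: normr_ge0.
have partial p : `|\sum_(k < n + p) u k - \sum_(k < n) u k| <=
    2 * c * (1 / 2) ^+ n * (1 - (1 / 2) ^+ p).
  elim: p => [|p ih]; first by rewrite addn0 !subrr normr0 mulr0.
  rewrite addnS big_ord_recr/= -addrAC.
  apply: (le_trans (ler_normD _ _)); apply: (le_trans (lerD ih (uc _))).
  rewrite exprD exprS le_eqVlt; apply/orP; left; apply/eqP.
  by field.
apply: (cvgr_to_le h); near=> m.
have nm : (n <= m)%N by near: m; exact: nbhs_infty_ge.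
rewrite distrC -(subnKC nm); apply: (le_trans (partial _)).
apply: ler_piMr; first by rewrite mulr_ge0 ?exprn_ge0 ?mulr_ge0.
by rewrite gerBl exprn_ge0.
Unshelve. all: by end_near.
Qed.

End geometric_bound.

Section limit_cf_bounds.
Variable R : realType.
Variables (a t A B : R).
Hypothesis a0 : 0 < a.
Let re_cvg := \sum_(k < n) cf_re a t k @[n --> \oo] --> A.
Let im_cvg := \sum_(k < n) cf_im a t k @[n --> \oo] --> B.

Let ak0 k : 0 < a * 2 ^+ k. Proof. by rewrite mulr_gt0// exprn_gt0. Qed.

Lemma cf_re_le k : - (t ^+ 2 / (2 * a) * (1 / 2) ^+ k) <= cf_re a t k <= 0.
Proof.
rewrite /cf_re; apply/andP; split; last first.
  by rewrite mulr_ge0_le0 ?(ltW (ak0 k))// subr_le0 cos_le1.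
have -> : - (t ^+ 2 / (2 * a) * (1 / 2) ^+ k) =
    a * 2 ^+ k * (- ((t / (a * 2 ^+ k)) ^+ 2 / 2)).
  rewrite !expr_div_n expr1n; field.
  by rewrite (gt_eqF a0)/= expf_neq0.
apply: ler_wpM2l; first exact: ltW.
have := cos_ge_quad (t / (a * 2 ^+ k)); lra.
Qed.

Lemma cf_im_le k : `|cf_im a t k| <= t ^+ 2 / (2 * a) * (1 / 2) ^+ k.
Proof.
rewrite /cf_im normrM (ger0_norm (ltW (ak0 k))).
have -> : t ^+ 2 / (2 * a) * (1 / 2) ^+ k =
    a * 2 ^+ k * ((t / (a * 2 ^+ k)) ^+ 2 / 2).
  rewrite !expr_div_n expr1n; field.
  by rewrite (gt_eqF a0)/= expf_neq0.
apply: ler_wpM2l; [exact: ltW|exact: norm_sin_subr].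
Qed.

Lemma cf_re_approx n : re_cvg -> `|\sum_(k < n) cf_re a t k - A| <= t ^+ 2 / a * (1 / 2) ^+ n.
Proof.
move=> lim; have -> : t ^+ 2 / a = 2 * (t ^+ 2 / (2 * a)) by field; rewrite gt_eqF.
apply: geometric_series_cvg_bound => // k.
have /andP[h1 h2] := cf_re_le k.
by rewrite ler0_norm// lerNl.
Qed.

Lemma cf_im_approx n : im_cvg -> `|\sum_(k < n) cf_im a t k - B| <= t ^+ 2 / a * (1 / 2) ^+ n.
Proof.
move=> lim; have -> : t ^+ 2 / a = 2 * (t ^+ 2 / (2 * a)) by field; rewrite gt_eqF.
by apply: geometric_series_cvg_bound => // k; exact: cf_im_le.
Qed.

Lemma norm_cf_re_lim : re_cvg -> `|A| <= t ^+ 2 / a.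
Proof. by move=> /(cf_re_approx 0); rewrite big_ord0 sub0r normrN expr0 mulr1. Qed.

Lemma norm_cf_im_lim : im_cvg -> `|B| <= t ^+ 2 / a.
Proof. by move=> /(cf_im_approx 0); rewrite big_ord0 sub0r normrN expr0 mulr1. Qed.

Lemma cf_re_lim_le k : re_cvg -> A <= cf_re a t k.
Proof.
move=> Alim; apply: (cvgr_to_le Alim); near=> n.
have kn : (k < n)%N by near: n; exact: nbhs_infty_gt.
rewrite (bigD1 (Ordinal kn))//= gerDl; apply: sumr_le0 => i _.
by case/andP: (cf_re_le i).
Unshelve. all: by end_near.
Qed.

Lemma cf_re_lim_le0 : re_cvg -> A <= 0.
Proof. by move=> lim; apply: (le_trans (cf_re_lim_le 0 lim)); case/andP: (cf_re_le 0). Qed.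

(* Some rescaled argument |t| / (a 2^k) lies in (1/2, 1], where 1 - cos is of
   order one; its weight a 2^k is at least |t|. *)
Lemma cf_re_lim_le_lin : re_cvg -> a <= `|t| -> A <= - (`|t| / 8).
Proof.
move=> lim at_.
have t0 : 0 < `|t| by rewrite (lt_le_trans a0).
have ex : exists k, `|t| <= a * 2 ^+ k.
  exists (Num.bound (`|t| / a)); rewrite mulrC -ler_pdivrMr//.
  have := archi_boundP (_ : 0 <= `|t| / a); rewrite divr_ge0 ?(ltW a0)//.
  move=> /(_ isT)/ltW/le_trans; apply.
  by rewrite -natrX ler_nat ltnW// ltn_expl.
have := ex_minnP ex => -[k tk kmin].
have kt : a * 2 ^+ k <= 2 * `|t|.
  case: k {tk} kmin => [|k] kmin; first by rewrite expr0 mulr1; lra.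
  rewrite leNgt; apply/negP => h.
  have : `|t| <= a * 2 ^+ k by move: h; rewrite exprS; lra.
  by move=> /kmin; rewrite ltnn.
apply: (le_trans (cf_re_lim_le k lim)); rewrite /cf_re -cos_norm.
rewrite normrM normfV (gtr0_norm (ak0 k)).
set b := a * 2 ^+ k in tk kt *.
have b0 : 0 < b by exact: ak0.
have : `| `|t| / b| <= 1.
  by rewrite normrM normfV normr_id (gtr0_norm b0) ler_pdivrMr// mul1r.
move=> /cos_le_quad h.
have h1 : b * (cos (`|t| / b) - 1) <= b * (- ((`|t| / b) ^+ 2 / 4)).
  by rewrite ler_wpM2l ?(ltW b0)//; lra.
apply: (le_trans h1).
have -> : b * - ((`|t| / b) ^+ 2 / 4) = - (`|t| / 4 * (`|t| / b)).
  by field; rewrite gt_eqF.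
rewrite lerN2; have : 1 / 2 <= `|t| / b by rewrite ler_pdivlMr//; lra.
nra.
Qed.

End limit_cf_bounds.

(** * Tails and small balls of a weighted translate of W *)

Section limit_functional.
Variable R : realType.
Variable mu : probability R R.
Implicit Types (c s t a : R) (f : R -> R).

(* Integration against c times the law mu translated by s. *)
Definition mix c s f : R := c * Rintegral mu setT (fun w => f (w + s)).

Lemma bmf_shift f s : bmf f -> bmf (fun w => f (w + s)).
Proof.
move=> [mf [M hM]]; split; last by exists M.
by apply: (@measurableT_comp _ _ _ _ _ _ f) => //; exact: measurable_funD.
Qed.

Lemma bmf_integrable f : bmf f -> mu.-integrable setT (EFin \o f).
Proof.
move=> [mf [M hM]]; apply: measurable_bounded_integrable => //.
  by rewrite (le_lt_trans (probability_le1 _ _))// ltry.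
exists M; split; first exact: num_real.
by move=> y My x _ /=; rewrite (le_trans (hM x))// ltW.
Qed.

Lemma posfun_Rintegral : posfun (fun f => Rintegral mu setT f).
Proof.
split.
- by move=> f g bf bg; rewrite RintegralD//; exact: bmf_integrable.
- by move=> k f bf; rewrite RintegralZl//; exact: bmf_integrable.
- by move=> f g bf bg fg; rewrite le_Rintegral//; exact: bmf_integrable.
Qed.

Lemma posfun_mix c s : 0 <= c -> posfun (mix c s).
Proof.
move=> c0; split.
- move=> f g bf bg; rewrite /mix -mulrDr.
  by rewrite -(pfD posfun_Rintegral)//; exact: bmf_shift.
- move=> k f bf; rewrite /mix (pfZ posfun_Rintegral); first by ring.
  exact: bmf_shift.
- move=> f g bf bg fg; rewrite /mix ler_wpM2l//.
  by apply: (pf_le posfun_Rintegral) => //; exact: bmf_shift.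
Qed.

Lemma mix_bool c s (p : R -> bool) : measurable [set y | p (y + s)] ->
  mix c s (fun y => (p y)%:R) = c * fine (mu [set y | p (y + s)]).
Proof.
move=> mp; rewrite /mix; congr (_ * _); congr fine.
rewrite -[X in mu X]setIT -integral_indic//; apply: eq_integral => x _.
congr (_%:E); rewrite indicE; congr (_%:R); congr nat_of_bool.
by apply/idP/idP; rewrite ?inE.
Qed.

Lemma mix_cst c s k : mix c s (fun=> k) = c * k.
Proof.
rewrite /mix Rintegral_cst//; transitivity (c * (k * 1)); last by rewrite mulr1.
by congr (_ * (_ * _)); exact: (congr1 fine (probability_setT mu)).
Qed.

Lemma mix_le c s x :
  mix c s (fun y => (y <= x)%R%:R) = c * fine (mu [set` `]-oo, x - s]]).
Proof.
have E : [set y | y + s <= x] = [set` `]-oo, x - s]].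
  by apply/seteqP; split => y /=; rewrite in_itv/= lerBrDr.
by rewrite (@mix_bool c s (fun y => y <= x)) E.
Qed.

Lemma mix_far_small c s e : 0 <= c -> 0 < e ->
  exists N : R, mix c s (fun y => (N < `|y|)%R%:R) <= e.
Proof.
move=> c0 e0.
pose F n : set R := [set y | n%:R < `|y + s|].
have mF n : measurable (F n).
  have -> : F n = ~` [set` `[- n%:R - s, n%:R - s]].
    apply/seteqP; split => y; rewrite /F/= in_itv/= => h.
      apply/negP; rewrite negb_and -!ltNge; move: h; rewrite lter_normr.
      by move=> /orP[?|?]; apply/orP; [right|left]; lra.
    move/negP: h; rewrite negb_and -!ltNge lter_normr.
    by move=> /orP[?|?]; apply/orP; [right|left]; lra.
  exact: measurableC.
have capF : \bigcap_n F n = set0.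
  rewrite -subset0 => y /(_ (Num.bound `|y + s|) I); rewrite /F/=.
  by move=> /(lt_trans (archi_boundP (normr_ge0 _))); rewrite ltxx.
have : mu \o F @ \oo --> (mu (\bigcap_n F n)).
  apply: nonincreasing_cvg_mu => //.
  - by rewrite (le_lt_trans (probability_le1 _ _))// ltry.
  - by rewrite capF.
  - move=> m n mn; apply/subsetPset => y /=; apply: le_lt_trans.
    by rewrite ler_nat.
rewrite capF measure0 => /fine_cvgP[_] /cvgrPdist_le /(_ (e / (1 + c))).
have d0 : 0 < e / (1 + c) by rewrite divr_gt0//; lra.
move=> /(_ d0) [n _ /(_ n (leqnn _))] /=; rewrite sub0r normrN => h.
exists n%:R; rewrite (@mix_bool c s (fun y => n%:R < `|y|)); last exact: mF.
have /(le_trans (ler_norm _)) := h => h1.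
apply: (@le_trans _ _ (c * (e / (1 + c)))); first by rewrite ler_wpM2l.
rewrite mulrA ler_pdivrMr; nra.
Qed.

Variable a : R.
Hypothesis a0 : 0 < a.
Hypothesis cfW : forall t, exists A B : R,
  [/\ \sum_(k < n) cf_re a t k @[n --> \oo] --> A,
      \sum_(k < n) cf_im a t k @[n --> \oo] --> B,
      Rintegral mu setT (fun x => cos (t * x)) = expR A * cos (t * - log2 a + B) &
      Rintegral mu setT (fun x => sin (t * x)) = expR A * sin (t * - log2 a + B)].

Lemma mix_cf c s t : exists A B : R,
  [/\ \sum_(k < n) cf_re a t k @[n --> \oo] --> A,
      \sum_(k < n) cf_im a t k @[n --> \oo] --> B,
      mix c s (fun x => cos (t * x)) = c * (expR A * cos (t * (s - log2 a) + B)) &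
      mix c s (fun x => sin (t * x)) = c * (expR A * sin (t * (s - log2 a) + B))].
Proof.
have [A [B [Al Bl cE sE]]] := cfW t; exists A, B; split => //.
- congr (_ * _).
  transitivity (Rintegral mu setT (fun w => cos (t * w + t * s))).
    by apply: eq_Rintegral => w _; congr cos; ring.
  rewrite (pf_cos posfun_Rintegral) cE sE.
  have -> : t * (s - log2 a) + B = t * s + (t * - log2 a + B) by ring.
  by rewrite (cosD (t * s)); ring.
- congr (_ * _).
  transitivity (Rintegral mu setT (fun w => cos (t * w + (t * s - pi / 2)))).
    by apply: eq_Rintegral => w _; rewrite addrA cosBpihalf; congr sin; ring.
  rewrite (pf_cos posfun_Rintegral) cE sE.
  have -> : t * (s - log2 a) + B = t * s + (t * - log2 a + B) by ring.
  by rewrite sinBpihalf cosBpihalf (sinD (t * s)); ring.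
Qed.

(** The translate has mean s - log2 a; centred there, 1 - e^A cos B <= |A| + B^2/2, with |A| <=
    t^2/a and B^2 <= t^4/a^2 <= t^2/a^2 since t <= 1. *)
Lemma mix_far_le c s r : 0 <= c <= 1 -> 0 < r ->
  mix c s (fun y => (r + `|s - log2 a| < `|y|)%R%:R) <=
  4 * (a^-1 + (a ^+ 2)^-1) / r ^+ 2.
Proof.
move=> /andP[c0 c1] r0; apply: tail_le => //.
- exact: posfun_mix.
- by rewrite addr_ge0// invr_ge0 ?exprn_ge0 ?(ltW a0).
- move=> t /andP[t0 t1].
  have [A [B [Al Bl cE sE]]] := mix_cf c s t.
  set z := s - log2 a in cE sE *.
  have pm := posfun_mix s c0.
  have -> : mix c s (fun y => 1 - cos (t * y - t * z)) = c * (1 - expR A * cos B).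
    transitivity (mix c s (fun y => 1 + -1 * cos (t * y + - (t * z)))).
      by congr mix; apply/funext => y; ring.
    rewrite (pfD pm); [|exact: bmf_cst|exact/bmfZ/bmf_cos].
    rewrite (pfZ pm); last exact: bmf_cos.
    rewrite mix_cst (pf_cos pm) cE sE cosN sinN.
    have -> : cos B = cos (t * z + B - t * z) by congr cos; ring.
    by rewrite (cosB (t * z + B)); ring.
  have A0 := cf_re_lim_le0 a0 Al.
  have h1 := norm_cf_re_lim a0 Al; have h2 := norm_cf_im_lim a0 Bl.
  have h3 := expR_ge1Dx A; have h4 := cos_ge_quad B; have h5 := cos_le1 B.
  have e0 := expR_gt0 A; have e1 : expR A <= 1 by rewrite -expR0 ler_expR.
  have -> : (a^-1 + (a ^+ 2)^-1) * t ^+ 2 = t ^+ 2 / a + t ^+ 2 / a ^+ 2 by ring.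
  have B2 : B ^+ 2 <= t ^+ 2 / a ^+ 2.
    rewrite -real_normK ?num_real//.
    apply: (@le_trans _ _ ((t ^+ 2 / a) ^+ 2)); first by rewrite lerXn2r ?nnegrE// divr_ge0 ?sqr_ge0 ?(ltW a0).
    rewrite expr_div_n ler_wpM2r ?invr_ge0 ?exprn_ge0 ?(ltW a0)//.
    by rewrite -exprM ler_wiXn2l// ltW.
  have h6 : 1 - expR A * cos B <= `|A| + B ^+ 2 / 2.
    by rewrite ler0_norm//; nra.
  have h7 := sqr_ge0 B.
  have h8 : 0 <= 1 - expR A * cos B by nra.
  by nra.
- by move=> e e0; exact: mix_far_small.
Qed.

(** For |t| >= T >= a, e^A <= e^(-T/8) <= 8/T bounds each of the two parts of the transform, so b =
    16/T in [small_ball_le]. *)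
Lemma mix_small_ball c s T N h z : 0 <= c <= 1 -> (0 < N)%N -> a <= T ->
  N%:R * T * h <= 1 ->
  mix c s (fun y => (`|y - z| <= h)%R%:R) <= 4 / N%:R + 64 / T.
Proof.
move=> /andP[c0 c1] N0 aT NTh.
have T0 : 0 < T by exact: lt_le_trans aT.
have -> : 64 / T = 4 * (16 / T) by ring.
apply: small_ball_le NTh => //.
- exact: posfun_mix.
- by rewrite mix_cst mulr1.
- by rewrite divr_ge0// ltW.
- move=> t Tt; have [A [B [Al Bl -> ->]]] := mix_cf c s t.
  have Ale := cf_re_lim_le_lin a0 Al (le_trans aT Tt).
  set b := t * _ + B.
  have e0 := expR_gt0 A.
  have eA : expR A <= 8 / T.
    apply: (@le_trans _ _ (expR (- (T / 8)))); first by rewrite ler_expR; lra.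
    apply: (le_trans (expR_neg_le _)); first by rewrite divr_ge0// ltW.
    rewrite -[leRHS]invf_div lef_pV2 ?posrE ?divr_gt0//; first by lra.
    have : 0 < T / 8 by rewrite divr_gt0.
    lra.
  rewrite !normrM (ger0_norm c0) (ger0_norm (ltW e0)).
  have h1 : `|cos b| <= 1 := cos_max b.
  have h2 : `|sin b| <= 1 := sin_max b.
  have -> : 16 / T = 8 / T + 8 / T by field; rewrite gt_eqF.
  rewrite lerD//.
    rewrite (le_trans _ eA)// -[leRHS]mul1r ler_pM ?mulr_ge0 ?(ltW e0)//.
    by rewrite ler_piMr// ltW.
  rewrite (le_trans _ eA)// -[leRHS]mul1r ler_pM ?mulr_ge0 ?(ltW e0)//.
  by rewrite ler_piMr// ltW.
Qed.

End limit_functional.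

(** * The finite model: elementary events and their Fourier transform *)

Section configurations.
Variable R : realType.
Variables (n K : nat).
Implicit Types f : {ffun 'I_n -> 'I_K}.

(* [f i] encodes the value 2^(f i + 1) of the i-th variable. *)
Definition cfg_weight f : R := \prod_i ((2 : R) ^+ (f i).+1)^-1.
Definition cfg_sum f : R := \sum_i (2 : R) ^+ (f i).+1.
(* The largest value 2^(k+1) is attained exactly m times (for m > 0). *)
Definition cfg_set (k m : nat) : {set {ffun 'I_n -> 'I_K}} :=
  [set f : {ffun 'I_n -> 'I_K} |
    [forall i, (f i <= k)%N] && (#|[pred i | f i == k :> nat]| == m)]%SET.
Definition cfg_pos k f : R :=
  (cfg_sum f - 2 ^+ k.+1) / n%:R - log2 (n%:R : R).
Definition cfg_fun k m (h : R -> R) : R :=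
  \sum_(f in cfg_set k m) cfg_weight f * h (cfg_pos k f).

Lemma cfg_weight_ge0 f : 0 <= cfg_weight f.
Proof. by apply: prodr_ge0 => i _; rewrite invr_ge0 exprn_ge0. Qed.

Lemma posfun_cfg k m : posfun (cfg_fun k m).
Proof.
split=> [h h' _ _|c h _|h h' _ _ hh'].
- by rewrite /cfg_fun -big_split/=; apply: eq_bigr => f _; rewrite mulrDr.
- by rewrite /cfg_fun mulr_sumr; apply: eq_bigr => f _; rewrite mulrCA.
- by apply: ler_sum => f _; rewrite ler_wpM2l ?cfg_weight_ge0.
Qed.

Lemma sum_pow2V k : \sum_(l < k) ((2 : R) ^+ l.+1)^-1 = 1 - (2 ^+ k)^-1.
Proof.
elim: k => [|k ih]; first by rewrite big_ord0 expr0 invr1 subrr.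
by rewrite big_ord_recr/= ih exprS invfM; field; rewrite expf_neq0.
Qed.

Lemma sum_cfg_weight (Q : {set {ffun 'I_n -> 'I_K}}) :
  \sum_(f in Q) cfg_weight f <= 1.
Proof.
apply: (@le_trans _ _ (\sum_f cfg_weight f)).
  rewrite big_mkcond; apply: ler_sum => f _.
  by case: ifP => // _; exact: cfg_weight_ge0.
rewrite -(bigA_distr_bigA (fun (i : 'I_n) (l : 'I_K) => ((2 : R) ^+ l.+1)^-1)).
rewrite prodr_const sum_pow2V; apply: exprn_ile1.
  by rewrite subr_ge0 invf_le1 ?exprn_gt0// exprn_ege1// ler1n.
by rewrite gerBl invr_ge0 exprn_ge0.
Qed.

Lemma cfg_mass_le1 k m : cfg_fun k m (fun=> 1) <= 1.
Proof.
rewrite /cfg_fun; under eq_bigr do rewrite mulr1; exact: sum_cfg_weight.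
Qed.

Lemma cfg_far_small k m e : 0 <= e ->
  exists N : R, cfg_fun k m (fun y => (N < `|y|)%R%:R) <= e.
Proof.
move=> e0; exists (\sum_f `|cfg_pos k f|); rewrite /cfg_fun big1// => f _.
rewrite ltNge (bigD1 f)//= lerDl sumr_ge0//= ?mulr0// => i _.
Qed.

Lemma coef_linear_exp (C : comNzRingType) (z c : C) m : (m <= n)%N ->
  ((z%:P + c *: 'X) ^+ n)`_m = z ^+ (n - m) * c ^+ m *+ 'C(n, m).
Proof.
move=> mn; rewrite exprDn coef_sum.
have mn' : (m < n.+1)%N by [].
rewrite (bigD1 (Ordinal mn'))//= big1 => [|i im].
  by rewrite addr0 coefMn exprZn -polyC_exp -scalerAr coefZ mulrC coefCM coefXn eqxx mulr1 mulrC.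
rewrite coefMn exprZn -polyC_exp -scalerAr coefZ coefCM coefXn.
rewrite (_ : (m == i) = false) ?mulr0 ?mul0rn//.
by apply/negbTE; apply: contra im => /eqP mi; apply/eqP/val_inj; rewrite /= mi.
Qed.

(* The number of maximal coordinates is marked by the exponent of 'X. *)
Lemma sum_cfg_prod (c : nat -> R[i]) k m : (k < K)%N -> (m <= n)%N ->
  \sum_(f in cfg_set k m) \prod_i c (f i) =
  (\sum_(l < k) c l) ^+ (n - m) * c k ^+ m *+ 'C(n, m).
Proof.
move=> kK mn; rewrite -coef_linear_exp//.
(* A value above level k gets weight 0, which removes the forbidden configurations when the power is
   expanded. *)
pose F (l : 'I_K) : {poly R[i]} := if (l <= k)%N then c l *: 'X^(l == k :> nat) else 0.
have -> : (\sum_(l < k) c l)%:P + c k *: 'X = \sum_l F l.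
  rewrite /F -big_mkcond/= (eq_bigl (fun l : 'I_K => (l < k.+1)%N))//.
  rewrite -(@big_ord_widen _ _ _ k.+1 K (fun l => c l *: 'X^(l == k)))// big_ord_recr/= eqxx expr1.
  congr (_ + _); rewrite rmorph_sum/=; apply: eq_bigr => l _.
  by rewrite ltn_eqF// expr0 alg_polyC.
have -> : (\sum_l F l) ^+ n = \sum_(f : {ffun 'I_n -> 'I_K}) \prod_i F (f i).
  by rewrite -(bigA_distr_bigA (fun (i : 'I_n) l => F l)) prodr_const card_ord.
rewrite coef_sum big_mkcond/=; apply: eq_bigr => f _.
rewrite inE; case: (boolP [forall i, (f i <= k)%N]) => [/forallP fk|/forallPn[i ik]] /=; last first.
  by rewrite (bigD1 i)//= /F (negbTE ik) mul0r coef0.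
have -> : \prod_i F (f i) = (\prod_i c (f i)) *: 'X^#|[pred i | f i == k :> nat]|.
  under eq_bigr do rewrite /F fk.
  rewrite scaler_prod; congr (_ *: _).
  rewrite prodrXr; congr ('X^_).
  rewrite -sum1_card [RHS]big_mkcond/=; apply: eq_bigr => i _.
  by rewrite inE; case: (_ == _).
rewrite coefZ coefXn eq_sym; case: eqP => _; by rewrite ?mulr1 ?mulr0.
Qed.

Definition lev (t : R) (l : nat) : R[i] :=
  ((((2 : R) ^+ l.+1)^-1)%:C)%C * cexp 0 (t * (2 ^+ l.+1 / n%:R)).
(* Fourier transform of X / n restricted to X <= 2^k. *)
Definition psi k t : R[i] := \sum_(l < k) lev t l.

(** The phase removes one maximal value 2^(k+1)/n and the centring log2 n. *)
Definition cfg_cf k m t : R[i] :=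
  cexp 0 (- t * (2 ^+ k.+1 / n%:R + log2 (n%:R : R))) *
  (psi k t ^+ (n - m) * lev t k ^+ m *+ 'C(n, m)).

Lemma cfg_cfE k m t : (k < K)%N -> (m <= n)%N ->
  cfg_fun k m (fun y => cos (t * y)) = complex.Re (cfg_cf k m t) /\
  cfg_fun k m (fun y => sin (t * y)) = complex.Im (cfg_cf k m t).
Proof.
move=> kK mn.
suff E : cfg_cf k m t = \sum_(f in cfg_set k m)
    ((cfg_weight f)%:C)%C * cexp 0 (t * cfg_pos k f).
  rewrite E Re_sum Im_sum; split; apply: eq_bigr => f _;
    by rewrite /= expR0 !mul1r !mul0r ?subr0 ?addr0.
rewrite /cfg_cf -sum_cfg_prod// mulr_sumr; apply: eq_bigr => f _.
rewrite /lev big_split/= -cexp_sum mulrCA; congr (_ * _).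
  by rewrite /cfg_weight rmorph_prod.
rewrite -cexpD addr0; congr cexp; rewrite -mulr_sumr -mulr_suml /cfg_pos /cfg_sum; ring.
Qed.

End configurations.

(** * Asymptotics of the transform at one level, with n = a 2^k *)

Section level_sum_asymptotics.
Variable R : realType.
Variables (n k : nat) (a : R).
Hypothesis a0 : 0 < a.
Hypothesis nE : n%:R = a * 2 ^+ k.
Local Notation nc := (@normc R).

Let n0 : 0 < n%:R :> R. Proof. by rewrite nE mulr_gt0// exprn_gt0. Qed.
Let n1 : 1 <= n%:R :> R. Proof. by rewrite ler1n -(ltr0n R). Qed.
Let ai0 i : 0 < a * 2 ^+ i. Proof. by rewrite mulr_gt0// exprn_gt0. Qed.

(** Counting levels from the top, l = k - 1 - i, turns the value 2^(l+1)/n into the atom 1/(a 2^i)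
    and its probability into a 2^i / n: n times the truncated law consists of the first k atoms of
    the Levy measure. *)
Lemma psi_rev t : psi n k t =
  \sum_(i < k) (((a * 2 ^+ i / n%:R)%:C)%C * cexp 0 (t / (a * 2 ^+ i))).
Proof.
rewrite /psi (reindex_inj rev_ord_inj)/=; apply: eq_bigr => i _.
rewrite /lev /= subnSK// expfB; last by rewrite ltn_ord.
congr ((_%:C)%C * cexp 0 (_ * _)); rewrite nE; field.
  by rewrite (gt_eqF a0) !expf_neq0.
by rewrite (gt_eqF a0) !expf_neq0.
Qed.

Lemma sum_levels : \sum_(i < k) a * 2 ^+ i = n%:R - a.
Proof.
have := subrX1 (2 : R) k; rewrite -mulr_sumr nE => h.
have -> : \sum_(i < k) (2 : R) ^+ i = 2 ^+ k - 1 by rewrite h; ring.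
by ring.
Qed.

(** There is no error term: each of the k atoms has weight times position equal to 1, whence the
    drift t k that compensates the series. *)
Lemma psiE t : psi n k t =
  (((n%:R - a + \sum_(i < k) cf_re a t i) / n%:R) +i*
   ((t * k%:R + \sum_(i < k) cf_im a t i) / n%:R))%C.
Proof.
rewrite psi_rev; apply/eqP; rewrite eq_complex Re_sum Im_sum /=; apply/andP; split; apply/eqP.
  rewrite -sum_levels -big_split/= mulr_suml; apply: eq_bigr => i _.
  by rewrite expR0 /cf_re; ring.
have -> : t * k%:R = \sum_(i < k) t by rewrite sumr_const card_ord mulr_natr.
rewrite -big_split/= mulr_suml; apply: eq_bigr => i _.
rewrite expR0 /cf_im; field.
by rewrite (gt_eqF n0) (gt_eqF a0) expf_neq0.
Qed.

Lemma normc_psi_le1 t : nc (psi n k t) <= 1.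
Proof.
rewrite (le_trans (ler_normc_sum _ _ _))//.
under eq_bigr do rewrite normcM normc_cexp expR0 mulr1 normc_real.
rewrite (eq_bigr (fun l : 'I_k => ((2 : R) ^+ l.+1)^-1)) => [|l _]; last first.
  by rewrite ger0_norm// invr_ge0 exprn_ge0.
by rewrite sum_pow2V gerBl invr_ge0 exprn_ge0.
Qed.

(** A bound for the modulus of the exponent (-a + A) + i (t k + B). *)
Definition cf_err t : R := a + 2 * t ^+ 2 / a + `|t| * k%:R.

Section approx.
Variables (t A B : R).
Hypothesis Alim : \sum_(i < n) cf_re a t i @[n --> \oo] --> A.
Hypothesis Blim : \sum_(i < n) cf_im a t i @[n --> \oo] --> B.

(** Only the tails of the two series remain, each at most (t^2/a) 2^(-k) = t^2/n before the division
    by n. *)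
Lemma psi_approx :
  nc (psi n k t - 1 - (((- a + A) / n%:R) +i* ((t * k%:R + B) / n%:R))%C) <=
  2 * t ^+ 2 / n%:R ^+ 2.
Proof.
rewrite psiE; set SA := \sum_(i < k) cf_re _ _ _; set SB := \sum_(i < k) cf_im _ _ _.
apply: (le_trans (normc_le_ReIm _)) => /=.
have -> : (n%:R - a + SA) / n%:R - 1 - (- a + A) / n%:R = (SA - A) / n%:R.
  by field; rewrite gt_eqF.
have -> : (t * k%:R + SB) / n%:R - 0 - (t * k%:R + B) / n%:R = (SB - B) / n%:R.
  by field; rewrite gt_eqF.
rewrite !normrM !normfV (gtr0_norm n0) -mulrDl.
have hn : t ^+ 2 / a * (1 / 2) ^+ k = t ^+ 2 / n%:R.
  by rewrite nE expr_div_n expr1n; field; rewrite (gt_eqF a0) expf_neq0.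
have := cf_re_approx a0 k Alim; have := cf_im_approx a0 k Blim.
rewrite !hn -/SA -/SB => h1 h2.
have -> : 2 * t ^+ 2 / n%:R ^+ 2 = (t ^+ 2 / n%:R + t ^+ 2 / n%:R) / n%:R.
  by field; rewrite gt_eqF.
by rewrite ler_wpM2r ?invr_ge0 ?(ltW n0)// lerD.
Qed.

Let D := cf_err t.

(** The target is the n-th power of exp((x + i y)/n), and both bases have modulus at most 1, so n
    times a difference of order D^2/n^2 remains. The m missing factors cost m |psi - 1|. *)
Lemma psi_pow_approx m : (m <= n)%N ->
  nc (psi n k t ^+ (n - m) - cexp (- a + A) (t * k%:R + B)) <=
  (2 * t ^+ 2 + 2 * D ^+ 2 + m%:R * (D + 2 * t ^+ 2)) / n%:R.
Proof.
move=> mn.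
set x := - a + A; set y := t * k%:R + B.
have A0 : A <= 0 := cf_re_lim_le0 a0 Alim.
have hA := norm_cf_re_lim a0 Alim; have hB := norm_cf_im_lim a0 Blim.
have x0 : x <= 0 by rewrite /x addrC subr_le0 (le_trans A0)// ltW.
have t2 : 0 <= t ^+ 2 := sqr_ge0 t.
have t2a : 0 <= t ^+ 2 / a by rewrite divr_ge0// ltW.
have xyD : `|x| + `|y| <= D.
  have h1 : `|x| <= a + t ^+ 2 / a.
    by rewrite (le_trans (ler_normD _ _))// normrN (gtr0_norm a0) lerD2l.
  have h2 : `|y| <= `|t| * k%:R + t ^+ 2 / a.
    by rewrite (le_trans (ler_normD _ _))// normrM normr_nat lerD2l.
  rewrite /D /cf_err -mulrA; lra.
have D0 : 0 <= D by rewrite (le_trans _ xyD)// addr_ge0.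
have x2y2 : x ^+ 2 + y ^+ 2 <= D ^+ 2.
  rewrite -(real_normK (num_real x)) -(real_normK (num_real y)).
  have : (`|x| + `|y|) ^+ 2 <= D ^+ 2.
    by apply: lerXn2r => //; rewrite nnegrE// addr_ge0.
  have : 0 <= `|x| * `|y| by rewrite mulr_ge0.
  by rewrite sqrrD; lra.
have nV0 : 0 <= n%:R^-1 :> R by rewrite invr_ge0 ltW.
have n2 : (n%:R ^+ 2)^-1 <= n%:R^-1 :> R.
  by rewrite lef_pV2 ?posrE ?exprn_gt0// expr2 ler_peMl// ltW.
have small : nc (psi n k t - 1) <= (D + 2 * t ^+ 2) / n%:R.
  have -> : psi n k t - 1 = (psi n k t - 1 - ((x / n%:R) +i* (y / n%:R))%C) +
    ((x / n%:R) +i* (y / n%:R))%C by rewrite subrK.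
  apply: (le_trans (ler_normcD _ _)).
  rewrite addrC [leRHS]mulrDl; apply: lerD.
    apply: (le_trans (normc_le_ReIm _)) => /=.
    by rewrite !normrM !normfV (gtr0_norm n0) -mulrDl ler_wpM2r.
  apply: (le_trans psi_approx).
  by rewrite ler_wpM2l// mulr_ge0.
have cE : cexp x y = cexp (x / n%:R) (y / n%:R) ^+ n.
  by rewrite cexpXn -[x / _ *+ n]mulr_natr -[y / _ *+ n]mulr_natr !divfK ?gt_eqF.
have xn0 : x / n%:R <= 0 by rewrite mulr_le0_ge0.
have main : nc (psi n k t ^+ n - cexp x y) <= (2 * t ^+ 2 + 2 * D ^+ 2) / n%:R.
  rewrite cE; apply: (le_trans (normc_expB _ _ _)).
  - exact: normc_psi_le1.
  - by rewrite normc_cexp -[leRHS]expR0 ler_expR.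
  have -> : psi n k t - cexp (x / n%:R) (y / n%:R) =
    (psi n k t - 1 - ((x / n%:R) +i* (y / n%:R))%C) -
    (cexp (x / n%:R) (y / n%:R) - 1 - ((x / n%:R) +i* (y / n%:R))%C) by ring.
  have h : nc (psi n k t - 1 - ((x / n%:R) +i* (y / n%:R))%C -
    (cexp (x / n%:R) (y / n%:R) - 1 - ((x / n%:R) +i* (y / n%:R))%C)) <=
      (2 * t ^+ 2 + 2 * D ^+ 2) / n%:R ^+ 2.
    apply: (le_trans (ler_normcB _ _)); rewrite [leRHS]mulrDl; apply: lerD.
      exact: psi_approx.
    apply: (le_trans (normc_cexp_sub1 _ xn0)).
    rewrite !expr_div_n -mulrDl mulrA ler_wpM2r ?invr_ge0 ?exprn_ge0 ?(ltW n0)//.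
    by rewrite ler_wpM2l.
  apply: (le_trans (ler_wpM2l (ltW n0) h)).
  by rewrite le_eqVlt; apply/orP; left; apply/eqP; field; rewrite gt_eqF.
have -> : psi n k t ^+ (n - m) - cexp x y =
    (psi n k t ^+ n - cexp x y) + psi n k t ^+ (n - m) * (1 - psi n k t ^+ m).
  by rewrite mulrBr mulr1 -exprD subnK//; ring.
apply: (le_trans (ler_normcD _ _)); rewrite [leRHS]mulrDl; apply: lerD => //.
rewrite normcM normcX -mulrA.
have p1 := normc_psi_le1 t.
apply: (@le_trans _ _ (1 * nc (1 - psi n k t ^+ m))).
  by rewrite ler_wpM2r ?normc_ge0// exprn_ile1// normc_ge0.
rewrite mul1r -normcNE opprB.
have := @normc_expB R (psi n k t) 1 m p1 _.
rewrite normc1 lexx expr1n => /(_ isT) h; apply: (le_trans h).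
by rewrite ler_wpM2l.
Qed.

End approx.

Lemma ffact_ratio m : (m <= n)%N ->
  1 - m%:R ^+ 2 / n%:R <= ((n ^_ m)%:R : R) / n%:R ^+ m <= 1.
Proof.
elim: m => [|m ih] mn; first by rewrite expr0n/= mul0r subr0 ffactn0 expr0 divr1 lexx.
have /andP[h1 h2] := ih (ltnW mn).
have h0 : 0 <= (n ^_ m)%:R / n%:R ^+ m :> R by rewrite divr_ge0// exprn_ge0// ltW.
have -> : (n ^_ m.+1)%:R / n%:R ^+ m.+1 =
    (n ^_ m)%:R / n%:R ^+ m * (1 - m%:R / n%:R) :> R.
  rewrite ffactnSr natrM natrB ?(ltnW mn)// exprS; field.
  by rewrite (gt_eqF n0) expf_neq0// gt_eqF.
have m1 : m%:R / n%:R <= 1 :> R by rewrite ler_pdivrMr// mul1r ler_nat ltnW.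
have m0 : 0 <= m%:R / n%:R :> R by rewrite divr_ge0// ltW.
apply/andP; split; last by rewrite mulr_ile1//; lra.
have h3 : (1 - m%:R ^+ 2 / n%:R) * (1 - m%:R / n%:R) <=
    (n ^_ m)%:R / n%:R ^+ m * (1 - m%:R / n%:R) :> R.
  by rewrite ler_wpM2r// subr_ge0.
apply: le_trans h3.
have -> : m.+1%:R ^+ 2 / n%:R = m%:R ^+ 2 / n%:R + 2 * (m%:R / n%:R) + n%:R^-1 :> R.
  by rewrite -natr1; field; rewrite gt_eqF.
have : 0 <= n%:R^-1 :> R by rewrite invr_ge0 ltW.
have : 0 <= m%:R ^+ 2 / n%:R * (m%:R / n%:R) :> R.
  by rewrite mulr_ge0// divr_ge0 ?exprn_ge0 ?(ltW n0).
lra.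
Qed.

(** Binomial weight of m maxima, each of probability 2^-(k+1) = (a/2)/n; [top_lim] is its Poisson
    limit without the exponential factor. *)
Definition top_coef m : R := 'C(n, m)%:R / (2 ^+ k.+1) ^+ m.
Definition top_lim m : R := (a / 2) ^+ m / m`!%:R.

Lemma top_coefE m : top_coef m = top_lim m * ((n ^_ m)%:R / n%:R ^+ m).
Proof.
rewrite /top_coef /top_lim -bin_ffact natrM.
have -> : a / 2 = n%:R / 2 ^+ k.+1.
  by rewrite nE exprS; field; rewrite expf_neq0.
rewrite expr_div_n; field.
by rewrite expf_neq0 ?(gt_eqF n0)//= pnatr_eq0 -lt0n fact_gt0 !expf_neq0.
Qed.

Lemma top_lim_ge0 m : 0 <= top_lim m.
Proof. by rewrite divr_ge0// exprn_ge0// divr_ge0// ltW. Qed.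

Lemma top_coef_close m : (m <= n)%N ->
  `|top_coef m - top_lim m| <= top_lim m * (m%:R ^+ 2 / n%:R).
Proof.
move=> mn; rewrite top_coefE -[X in _ - X]mulr1 -mulrBr normrM ger0_norm ?top_lim_ge0//.
rewrite ler_wpM2l ?top_lim_ge0//.
by have /andP[? ?] := ffact_ratio mn; rewrite ler0_norm; lra.
Qed.

Lemma top_coef_le m : (m <= n)%N -> 0 <= top_coef m <= top_lim m.
Proof.
move=> mn; rewrite divr_ge0 ?exprn_ge0//= top_coefE ler_piMr ?top_lim_ge0//.
by have /andP[] := ffact_ratio mn.
Qed.

(** One of the m + 1 maxima is trimmed, so m steps of 2^(k+1)/n = 2/a remain; -k is left to cancel
    the drift t k of the power of psi. *)
Lemma cfg_cf_factor m t : cfg_cf n k m.+1 t =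
  ((top_coef m.+1)%:C)%C *
  cexp 0 (t * (2 * m%:R / a - log2 a - k%:R)) * psi n k t ^+ (n - m.+1).
Proof.
have lE : log2 (n%:R : R) = log2 a + k%:R.
  rewrite nE log2M ?exprn_gt0//; congr (_ + _).
  by have := log2_pow2z R k; rewrite -exprnP.
have nE' : 2 ^+ k.+1 / n%:R = 2 / a.
  by rewrite nE exprS; field; rewrite (gt_eqF a0) expf_neq0.
rewrite /cfg_cf /lev nE' lE exprMn cexpXn mul0rn -[_ *+ 'C(_, _)]mulr_natr.
set p := psi n k t ^+ _.
transitivity ((((2 ^+ k.+1)^-1)%:C)%C ^+ m.+1 * 'C(n, m.+1)%:R *
  (cexp 0 (- t * (2 / a + (log2 a + k%:R))) * cexp 0 ((t * (2 / a)) *+ m.+1)) * p).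
  by ring.
congr (_ * _ * _).
  rewrite /top_coef -rmorphXn/= -(rmorph_nat (real_complex R)) -rmorphM/=.
  by rewrite exprVn mulrC.
rewrite -cexpD addr0; congr cexp.
by rewrite -mulr_natr -natr1; ring.
Qed.

Lemma cfg_cf_close m t A B : (m.+1 <= n)%N ->
  \sum_(i < n) cf_re a t i @[n --> \oo] --> A ->
  \sum_(i < n) cf_im a t i @[n --> \oo] --> B ->
  nc (cfg_cf n k m.+1 t -
      ((top_lim m.+1 * expR (- a))%:C)%C * cexp A (t * (2 * m%:R / a - log2 a) + B)) <=
  top_lim m.+1 * ((m.+1%:R ^+ 2 + 2 * t ^+ 2 + 2 * cf_err t ^+ 2 +
    m.+1%:R * (cf_err t + 2 * t ^+ 2)) / n%:R).
Proof.
move=> mn Al Bl; set D := cf_err t; rewrite cfg_cf_factor.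
set e := cexp 0 _; set p := psi n k t ^+ _.
have -> : ((top_lim m.+1 * expR (- a))%:C)%C * cexp A (t * (2 * m%:R / a - log2 a) + B) =
    ((top_lim m.+1)%:C)%C * e * cexp (- a + A) (t * k%:R + B).
  have -> : ((top_lim m.+1 * expR (- a))%:C)%C = ((top_lim m.+1)%:C)%C * cexp (- a) 0.
    by rewrite /cexp cos0 sin0 mulr1 mulr0 rmorphM.
  rewrite -!mulrA -!cexpD; congr (_ * cexp _ _); ring.
set w := cexp (_ + _) _.
have -> : ((top_coef m.+1)%:C)%C * e * p - ((top_lim m.+1)%:C)%C * e * w =
    ((top_coef m.+1 - top_lim m.+1)%:C)%C * e * p +
    ((top_lim m.+1)%:C)%C * e * (p - w) by rewrite rmorphB/=; ring.
apply: (le_trans (ler_normcD _ _)); rewrite !normcM !normc_real normc_cexp expR0 !mulr1.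
have -> : (m.+1%:R ^+ 2 + 2 * t ^+ 2 + 2 * D ^+ 2 + m.+1%:R * (D + 2 * t ^+ 2)) / n%:R =
  m.+1%:R ^+ 2 / n%:R + (2 * t ^+ 2 + 2 * D ^+ 2 + m.+1%:R * (D + 2 * t ^+ 2)) / n%:R.
  by ring.
rewrite mulrDr lerD//.
  apply: le_trans (top_coef_close mn).
  by rewrite ler_piMr// normcX exprn_ile1 ?normc_ge0// normc_psi_le1.
rewrite ger0_norm ?top_lim_ge0// ler_wpM2l ?top_lim_ge0//.
exact: psi_pow_approx.
Qed.

(** The mean of X/n given X <= 2^k: first moment k/n over mass (n - a)/n. Accordingly [cfg_center]
    is the mean of the trimmed variable on the class. *)
Definition level_mean : R := k%:R / (n%:R - a).
Definition cfg_center m : R :=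
  2 * m%:R / a - log2 a - k%:R + (n - m.+1)%:R * level_mean.

Lemma psi0 : psi n k 0 = (((n%:R - a) / n%:R)%:C)%C.
Proof.
rewrite psi_rev -sum_levels mulr_suml rmorph_sum/=; apply: eq_bigr => i _.
by rewrite mul0r cexp00 mulr1.
Qed.

(* Centering at the mean of the normalised truncated law removes the linear term. *)
Lemma psi_centered t : a < n%:R ->
  normc (cexp 0 (- (t * level_mean)) * psi n k t - psi n k 0) <=
  2 / (n%:R * a) * t ^+ 2.
Proof.
move=> an.
set mu := level_mean.
pose p i := a * 2 ^+ i / n%:R.
pose x i := (a * 2 ^+ i)^-1.
have p0 i : 0 <= p i by rewrite divr_ge0// ltW.
have na : n%:R - a != 0 by rewrite subr_eq0 gt_eqF.
have sp : \sum_(i < k) p i = (n%:R - a) / n%:R by rewrite -mulr_suml sum_levels.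
have spx : \sum_(i < k) p i * x i = k%:R / n%:R.
  rewrite -[in RHS](card_ord k) -sumr_const mulr_suml; apply: eq_bigr => i _.
  rewrite /p /x; field.
  by rewrite (gt_eqF n0) (gt_eqF a0) expf_neq0.
have spx2 : \sum_(i < k) p i * x i ^+ 2 <= 2 / (n%:R * a).
  rewrite (eq_bigr (fun i : 'I_k => 2 / (n%:R * a) * ((2 : R) ^+ i.+1)^-1)) => [|i _].
    rewrite -mulr_sumr sum_pow2V; apply: ler_piMr.
      by rewrite divr_ge0// mulr_ge0 ?(ltW n0) ?(ltW a0).
    by rewrite gerBl invr_ge0 exprn_ge0.
  rewrite /p /x (exprS _ i); field.
  by rewrite (gt_eqF n0) (gt_eqF a0) expf_neq0.
have c0 : \sum_(i < k) p i * (x i - mu) = 0.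
  under eq_bigr do rewrite mulrBr.
  rewrite sumrB -mulr_suml sp spx /mu /level_mean; field.
  by rewrite na (gt_eqF n0).
have -> : cexp 0 (- (t * mu)) * psi n k t - psi n k 0 =
    \sum_(i < k) ((p i)%:C)%C * (cexp 0 (t * (x i - mu)) - 1 - (0 +i* (t * (x i - mu)))%C).
  have -> : \sum_(i < k) ((p i)%:C)%C * (cexp 0 (t * (x i - mu)) - 1 - (0 +i* (t * (x i - mu)))%C) =
     \sum_(i < k) (((p i)%:C)%C * cexp 0 (t * (x i - mu)) - ((p i)%:C)%C -
        (0 +i* (t * (p i * (x i - mu))))%C).
    apply: eq_bigr => i _; rewrite !mulrBr mulr1; congr (_ - _).
    by apply/eqP; rewrite eq_complex/=; apply/andP; split; apply/eqP; ring.
  rewrite !sumrB.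
  have -> : \sum_(i < k) (0 +i* (t * (p i * (x i - mu))))%C = 0.
    apply/eqP; rewrite eq_complex Re_sum Im_sum /=; apply/andP; split; apply/eqP.
      by rewrite big1.
    by rewrite -mulr_sumr c0 mulr0.
  rewrite subr0; congr (_ - _).
    rewrite psi_rev mulr_sumr; apply: eq_bigr => i _.
    by rewrite mulrCA -cexpD addr0; congr (_ * cexp _ _); rewrite /x; ring.
  by rewrite psi0 -sp rmorph_sum.
apply: (le_trans (ler_normc_sum _ _ _)).
apply: (@le_trans _ _ (\sum_(i < k) p i * (t * (x i - mu)) ^+ 2)).
  apply: ler_sum => i _; rewrite normcM normc_real (ger0_norm (p0 i)).
  by rewrite ler_wpM2l// normc_cexp0_sub1.
(* A variance identity: the subtracted product is nonnegative, and the second moment is the sum of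
   the 1/(n a 2^i), at most 2/(n a). *)
have -> : \sum_(i < k) p i * (t * (x i - mu)) ^+ 2 =
    (\sum_(i < k) p i * x i ^+ 2 - mu * \sum_(i < k) p i * x i) * t ^+ 2.
  have h : \sum_(i < k) p i * (t * (x i - mu)) ^+ 2 =
    t ^+ 2 * (\sum_(i < k) p i * x i ^+ 2 - mu * \sum_(i < k) p i * x i
      - mu * \sum_(i < k) p i * (x i - mu)).
    rewrite !mulr_sumr -!sumrB mulr_sumr; apply: eq_bigr => i _; ring.
  by rewrite h c0; ring.
rewrite ler_wpM2r ?sqr_ge0//.
have : 0 <= mu * \sum_(i < k) p i * x i.
  by rewrite spx mulr_ge0// divr_ge0 ?(ltW n0)// subr_ge0 ltW.
lra.
Qed.

(** Additivity of variances: a centred factor differs from its mass by at most (2/(n a)) t^2, and at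
    most n factors give 2 t^2 / a. Comparing with the transform at 0 avoids dividing by the mass. *)
Lemma cfg_far_le (K m : nat) (r : R) : (k < K)%N -> (m.+1 <= n)%N -> a < n%:R ->
  0 < r ->
  @cfg_fun R n K k m.+1 (fun y => (r + `|cfg_center m| < `|y|)%R%:R) <=
  4 * (top_lim m.+1 * (2 / a)) / r ^+ 2.
Proof.
move=> kK mn an r0.
have pI := @posfun_cfg R n K k m.+1.
apply: tail_le => //.
- by rewrite mulr_ge0 ?top_lim_ge0// divr_ge0// ltW.
- move=> t _.
  have [cE sE] := cfg_cfE t kK mn.
  have [c0E _] := cfg_cfE (0 : R) kK mn.
  set I := cfg_fun _ _ _ _ in pI cE sE c0E *.
  set c := cfg_center m.
  have E1 : I (fun y => cos (t * y - t * c)) =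
      complex.Re (cexp 0 (- (t * c)) * cfg_cf n k m.+1 t).
    rewrite (pf_cos pI) cE sE; case: (cfg_cf _ _ _ _) => u v /=.
    by rewrite expR0 !mul1r.
  have E0 : I (fun=> 1) = complex.Re (cfg_cf n k m.+1 0).
    by rewrite -c0E; congr I; apply/funext => y; rewrite mul0r cos0.
  have -> : I (fun y => 1 - cos (t * y - t * c)) =
      complex.Re (cfg_cf n k m.+1 0 - cexp 0 (- (t * c)) * cfg_cf n k m.+1 t).
    transitivity (I (fun y => 1 + -1 * cos (t * y + - (t * c)))).
      by congr I; apply/funext => y; ring.
    rewrite (pfD pI); [|exact: bmf_cst|exact/bmfZ/bmf_cos].
    rewrite (pfZ pI); last exact: bmf_cos.
    rewrite E1 E0.
    by case: (cexp 0 _ * _) => u' v'; case: (cfg_cf _ _ _ 0) => u v /=; ring.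
  apply: (le_trans (ler_norm _)); apply: (le_trans (normc_Re _)).
  rewrite !cfg_cf_factor mul0r cexp00 mulr1.
  set b := ((top_coef m.+1)%:C)%C.
  have -> : b * psi n k 0 ^+ (n - m.+1) - cexp 0 (- (t * c)) *
      (b * cexp 0 (t * (2 * m%:R / a - log2 a - k%:R)) * psi n k t ^+ (n - m.+1)) =
      b * (psi n k 0 ^+ (n - m.+1) -
        (cexp 0 (- (t * level_mean)) * psi n k t) ^+ (n - m.+1)).
    rewrite [RHS]mulrBr; congr (_ - _); rewrite exprMn cexpXn mul0rn.
    transitivity (b * (cexp 0 (- (t * c)) * cexp 0 (t * (2 * m%:R / a - log2 a - k%:R))) *
      psi n k t ^+ (n - m.+1)); first by ring.
    rewrite -cexpD addr0 -mulrA; congr (_ * (cexp _ _ * _)).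
    by rewrite -mulr_natr /c /cfg_center; ring.
  rewrite normcM normc_real.
  have /andP[b0 b1] := top_coef_le mn; rewrite ger0_norm// -mulrA.
  apply: ler_pM => //; first exact: normc_ge0.
  apply: (le_trans (normc_expB _ _ _)).
  + exact: normc_psi_le1.
  + by rewrite normcM normc_cexp expR0 mul1r normc_psi_le1.
  rewrite -normcNE opprB.
  apply: (@le_trans _ _ (n%:R * (2 / (n%:R * a) * t ^+ 2))).
    apply: ler_pM => //; first exact: normc_ge0.
      by rewrite ler_nat leq_subr.
    exact: psi_centered.
  rewrite le_eqVlt; apply/orP; left; apply/eqP; field.
  by rewrite (gt_eqF n0) (gt_eqF a0).
- by move=> e e0; apply: cfg_far_small; exact: ltW.
Qed.

(** The divergent k cancels: -k + (n - m - 1) k/(n - a) = k (a - m - 1)/(n - a), and k <= 2^k = n/a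
    while n - a >= n/2. *)
Lemma cfg_center_le (m : nat) : (m.+1 <= n)%N -> 2 * a <= n%:R ->
  `|cfg_center m| <= 2 * m%:R / a + `|log2 a| + 2 * (a + m.+1%:R) / a.
Proof.
move=> mn an.
have na0 : 0 < n%:R - a by have := a0; lra.
have -> : cfg_center m = 2 * m%:R / a - log2 a + k%:R * (a - m.+1%:R) / (n%:R - a).
  rewrite /cfg_center /level_mean natrB//; field.
  by rewrite (gt_eqF na0) (gt_eqF a0).
apply: (le_trans (ler_normD _ _)); apply: lerD.
  apply: (le_trans (ler_normB _ _)); rewrite lerD2r ger0_norm//.
  by rewrite divr_ge0 ?mulr_ge0// ltW.
rewrite !normrM normfV (gtr0_norm na0) normr_nat.
have h1 : `|a - m.+1%:R| <= a + m.+1%:R.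
  by rewrite (le_trans (ler_normB _ _))// (gtr0_norm a0) normr_nat.
have h2 : k%:R / (n%:R - a) <= 2 / a.
  rewrite ler_pdivrMr// mulrAC ler_pdivlMr//.
  apply: (@le_trans _ _ n%:R); last by lra.
  by rewrite nE mulrC ler_wpM2l ?(ltW a0)// -natrX ler_nat ltnW// ltn_expl.
rewrite mulrAC [leRHS]mulrAC.
by apply: ler_pM => //; rewrite divr_ge0 ?(ltW na0).
Qed.

End level_sum_asymptotics.

(** * The limit theorem for a fixed (j, m) *)

Section local_limit.
Variable R : realType.
Implicit Types (a t r : R).

Lemma cube_le_exp2 k : (k.+1 ^ 3 <= 8 * 2 ^ k)%N.
Proof.
have h3 : (4 ^ 3 <= 8 * 2 ^ 3)%N by [].
case: (leqP 3 k) => [k3|]; last by case: k => [|[|[|]]].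
rewrite -(subnKC k3); elim: (k - 3)%N => [|p ih] //.
rewrite addnS (expnS 2) mulnCA; apply: leq_trans (_ : 2 * (3 + p).+1 ^ 3 <= _)%N.
  set q := (3 + p)%N; have q3 : (3 <= q)%N by exact: leq_addr.
  rewrite !expnS !expn0; nia.
by rewrite leq_mul2l ih orbT.
Qed.

(** Turns an error of order k^2/n into one of order 1/k, so that the divergence of the level is all
    that convergence requires. *)
Lemma level_sq_le (alo a : R) n k : 0 < alo -> alo <= a -> n%:R = a * 2 ^+ k ->
  k.+1%:R ^+ 2 / n%:R <= 8 / (alo * k.+1%:R).
Proof.
move=> alo0 aloa nE.
have a0 : 0 < a by exact: lt_le_trans aloa.
have n0 : 0 < n%:R :> R by rewrite nE mulr_gt0// exprn_gt0.
have k0 : 0 < k.+1%:R :> R by rewrite ltr0n.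
rewrite ler_pdivrMr// mulrAC ler_pdivlMr ?mulr_gt0//.
have h : k.+1%:R ^+ 3 <= 8 * 2 ^+ k :> R.
  by rewrite -!natrX -natrM ler_nat; exact: cube_le_exp2.
rewrite nE.
have -> : k.+1%:R ^+ 2 * (alo * k.+1%:R) = alo * k.+1%:R ^+ 3 by ring.
have -> : 8 * (a * 2 ^+ k) = a * (8 * 2 ^+ k) by ring.
by apply: ler_pM => //; exact: ltW.
Qed.

Lemma level_ge (ahi : R) (M : nat) : \forall n \near \oo, forall k a,
  0 < a <= ahi -> n%:R = a * 2 ^+ k -> (M <= k)%N.
Proof.
near=> n => k a /andP[a0 ah] nE; rewrite leqNgt; apply/negP => kM.
have : ahi * 2 ^+ M < n%:R by near: n; exact: nbhs_infty_gtr.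
rewrite nE ltNge => /negP; apply.
apply: ler_pM => //; first exact: ltW.
by rewrite ler_eXn2l ?ltr1n// ltnW.
Unshelve. all: by end_near.
Qed.

Definition mix_weight a m : R := top_lim a m.+1 * expR (- a).

Lemma mix_weight01 a m : 0 < a -> 0 <= mix_weight a m <= 1.
Proof.
move=> a0; rewrite /mix_weight mulr_ge0 ?expR_ge0 ?top_lim_ge0//=.
rewrite expRN ler_pdivrMr ?expR_gt0// mul1r.
have h : 0 <= a / 2 by rewrite divr_ge0// ltW.
apply: (@le_trans _ _ (expR (a / 2))).
  by have := expR_ge1Dxn m h; rewrite /top_lim; lra.
by rewrite ler_expR; lra.
Qed.

Lemma top_lim_le ahi a m : 0 < a <= ahi -> top_lim a m <= (ahi / 2) ^+ m.
Proof.
move=> /andP[a0 ah]; rewrite /top_lim ler_pdivrMr ?ltr0n ?fact_gt0//.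
apply: (@le_trans _ _ ((ahi / 2) ^+ m)).
  by rewrite lerXn2r ?nnegrE; lra.
by rewrite ler_peMr ?exprn_ge0 ?ler1n ?fact_gt0//; lra.
Qed.

Lemma pf_far_le (I : (R -> R) -> R) r r' : posfun I -> r <= r' ->
  I (fun y => (r' < `|y|)%R%:R) <= I (fun y => (r < `|y|)%R%:R).
Proof.
move=> pI rr'; apply: (pf_le pI); [exact: bmf_far..|move=> y].
case: (ltP r' `|y|) => //= h.
by rewrite (le_lt_trans rr' h).
Qed.

Lemma norm_log2_le alo ahi a : 0 < alo -> alo <= a <= ahi ->
  `|log2 a| <= `|log2 alo| + `|log2 ahi|.
Proof.
move=> alo0 /andP[h1 h2].
have := ler_log2 alo0 h1; have := ler_log2 (lt_le_trans alo0 h1) h2.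
have := ler_norm (log2 ahi); have := ler_norm (- log2 alo); rewrite normrN.
have := normr_ge0 (log2 alo); have := normr_ge0 (log2 ahi).
by rewrite ler_norml; lra.
Qed.

Definition has_cfW (mu : probability R R) a := forall t, exists A B : R,
  [/\ \sum_(k < n) cf_re a t k @[n --> \oo] --> A,
      \sum_(k < n) cf_im a t k @[n --> \oo] --> B,
      Rintegral mu setT (fun x => cos (t * x)) = expR A * cos (t * - log2 a + B) &
      Rintegral mu setT (fun x => sin (t * x)) = expR A * sin (t * - log2 a + B)].

Variables (alo ahi : R) (m : nat) (a_ : nat -> R) (k_ K_ : nat -> nat).
Variable mu_ : nat -> probability R R.
Hypothesis alo0 : 0 < alo.
Hypothesis setup : \forall n \near \oo,
  [/\ alo <= a_ n <= ahi, n%:R = a_ n * 2 ^+ k_ n, (k_ n < K_ n)%N &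
      has_cfW (mu_ n) (a_ n)].

(** [I n] is the contribution of one class and [J n] its prediction; [a_ n] may wander in a fixed
    compact interval of (0, oo). *)
Let I n := @cfg_fun R n (K_ n) (k_ n) m.+1.
Let J n := mix (mu_ n) (mix_weight (a_ n) m) (2 * m%:R / a_ n).

Lemma local_cf_cvg t : cf_dist (I n) (J n) t @[n --> \oo] --> 0.
Proof.
apply/cvgrPdist_le => e e0.
(* [cf_err] is at most q (k+1) and the numerator of the error at most Q (k+1)^2; with (k+1)^2/n <=
   8/(alo (k+1)) and a factor 2 for the two parts, the result is c/(k+1). *)
pose q := ahi + 2 * t ^+ 2 / alo + `|t|.
pose Q := m.+1%:R ^+ 2 + 2 * t ^+ 2 + 2 * q ^+ 2 + m.+1%:R * (q + 2 * t ^+ 2).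
pose c := 16 * (ahi / 2) ^+ m.+1 * Q / alo.
near=> n.
have [/andP[al ah] nE kK cfW] : [/\ alo <= a_ n <= ahi, n%:R = a_ n * 2 ^+ k_ n,
  (k_ n < K_ n)%N & has_cfW (mu_ n) (a_ n)] by near: n.
have mn : (m.+1 <= n)%N by near: n; exact: nbhs_infty_ge.
have a0 : 0 < a_ n by exact: lt_le_trans al.
have n0 : 0 < n%:R :> R by rewrite nE mulr_gt0// exprn_gt0.
rewrite sub0r normrN ger0_norm ?addr_ge0//.
have [A [B [Al Bl cE sE]]] := mix_cf cfW (mix_weight (a_ n) m) (2 * m%:R / a_ n) t.
have [icE isE] := cfg_cfE t kK mn.
have close := cfg_cf_close a0 nE mn Al Bl.
set z := cfg_cf _ _ _ _ in icE isE close.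
set w := _ * cexp _ _ in close.
have wRe : complex.Re w = mix (mu_ n) (mix_weight (a_ n) m) (2 * m%:R / a_ n) (fun x => cos (t * x)).
  by rewrite cE /w /= mul0r subr0.
have wIm : complex.Im w = mix (mu_ n) (mix_weight (a_ n) m) (2 * m%:R / a_ n) (fun x => sin (t * x)).
  by rewrite sE /w /= mul0r addr0.
have d1 : cf_dist (I n) (J n) t <= 2 * normc (z - w).
  rewrite /cf_dist /I /J icE isE -wRe -wIm.
  have h1 := normc_Re (z - w); have h2 := normc_Im (z - w).
  have -> : complex.Re z - complex.Re w = complex.Re (z - w) by case: (z) => ? ?; case: (w).
  have -> : complex.Im z - complex.Im w = complex.Im (z - w) by case: (z) => ? ?; case: (w).
  lra.
apply: (le_trans d1).
have k1 : 1 <= (k_ n).+1%:R :> R by rewrite ler1n.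
have t20 : 0 <= t ^+ 2 := sqr_ge0 t.
have tt0 : 0 <= 2 * t ^+ 2 by exact: mulr_ge0.
have D0 : 0 <= cf_err (k_ n) (a_ n) t.
  apply: addr_ge0; last by rewrite mulr_ge0.
  by apply: addr_ge0; [exact: ltW|apply: divr_ge0; [exact: mulr_ge0|exact: ltW]].
have Dq : cf_err (k_ n) (a_ n) t <= q * (k_ n).+1%:R.
  rewrite /cf_err /q.
  have h1 : 2 * t ^+ 2 / a_ n <= 2 * t ^+ 2 / alo.
    by apply: ler_wpM2l; rewrite ?lef_pV2.
  have h2 : `|t| * (k_ n)%:R <= `|t| * (k_ n).+1%:R.
    by rewrite ler_wpM2l// ler_nat.
  have h3 : ahi + 2 * t ^+ 2 / alo <= (ahi + 2 * t ^+ 2 / alo) * (k_ n).+1%:R.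
    apply: ler_peMr => //; apply: addr_ge0.
      by rewrite (le_trans _ ah)// ltW.
    by apply: divr_ge0 => //; exact: ltW.
  rewrite [leRHS]mulrDl; lra.
have q0 : 0 <= q.
  by rewrite -(@pmulr_lge0 _ (k_ n).+1%:R) ?ltr0n// (le_trans D0).
have kk : (k_ n).+1%:R <= (k_ n).+1%:R ^+ 2 :> R by rewrite expr2 ler_peMr//; lra.
have k2 : 1 <= (k_ n).+1%:R ^+ 2 :> R by exact: le_trans kk.
have polyQ : m.+1%:R ^+ 2 + 2 * t ^+ 2 + 2 * cf_err (k_ n) (a_ n) t ^+ 2 +
    m.+1%:R * (cf_err (k_ n) (a_ n) t + 2 * t ^+ 2) <= Q * (k_ n).+1%:R ^+ 2.
  have h1 : cf_err (k_ n) (a_ n) t ^+ 2 <= q ^+ 2 * (k_ n).+1%:R ^+ 2.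
    rewrite -exprMn; apply: lerXn2r => //; rewrite nnegrE// mulr_ge0//.
  have h2 : cf_err (k_ n) (a_ n) t <= q * (k_ n).+1%:R ^+ 2.
    by rewrite (le_trans Dq)// ler_wpM2l.
  have h3 : 2 * t ^+ 2 <= 2 * t ^+ 2 * (k_ n).+1%:R ^+ 2.
    by apply: ler_peMr.
  have h4 : m.+1%:R ^+ 2 <= m.+1%:R ^+ 2 * (k_ n).+1%:R ^+ 2 :> R.
    by rewrite ler_peMr// exprn_ge0.
  have h5 : m.+1%:R * (cf_err (k_ n) (a_ n) t + 2 * t ^+ 2) <=
      m.+1%:R * ((q + 2 * t ^+ 2) * (k_ n).+1%:R ^+ 2).
    by apply: ler_wpM2l => //; rewrite [leRHS]mulrDl; exact: lerD.
  rewrite /Q; move: h1 h2 h3 h4 h5.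
  set x := (k_ n).+1%:R ^+ 2; set d := cf_err _ _ _; set mm := m.+1%:R.
  move=> h1 h2 h3 h4 h5.
  have -> : (mm ^+ 2 + 2 * t ^+ 2 + 2 * q ^+ 2 + mm * (q + 2 * t ^+ 2)) * x =
    mm ^+ 2 * x + 2 * t ^+ 2 * x + 2 * (q ^+ 2 * x) + mm * ((q + 2 * t ^+ 2) * x) by ring.
  lra.
have Q0 : 0 <= Q.
  rewrite /Q; apply: addr_ge0; last by apply: mulr_ge0 => //; exact: addr_ge0.
  apply: addr_ge0; last by apply: mulr_ge0 => //; exact: sqr_ge0.
  by apply: addr_ge0 => //; exact: sqr_ge0.
have ahi0 : 0 <= ahi by rewrite (le_trans _ ah)// ltW.
have c0 : 0 <= c.
  by rewrite /c divr_ge0 ?(ltW alo0)// !mulr_ge0// exprn_ge0// divr_ge0.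
apply: (@le_trans _ _ (c / (k_ n).+1%:R)).
  apply: (@le_trans _ _ (2 * ((ahi / 2) ^+ m.+1 * (Q * (8 / (alo * (k_ n).+1%:R)))))).
    rewrite ler_wpM2l//; apply: (le_trans close); apply: ler_pM.
    - exact: top_lim_ge0.
    - apply: divr_ge0; last exact: ltW.
      apply: addr_ge0; last by apply: mulr_ge0 => //; exact: addr_ge0.
      apply: addr_ge0; last by apply: mulr_ge0 => //; exact: sqr_ge0.
      by apply: addr_ge0 => //; exact: sqr_ge0.
    - by apply: top_lim_le; rewrite a0.
    apply: (@le_trans _ _ (Q * (k_ n).+1%:R ^+ 2 / n%:R)).
      by rewrite ler_wpM2r// invr_ge0 ltW.
    by rewrite -mulrA; apply: ler_wpM2l => //; exact: level_sq_le nE.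
  rewrite le_eqVlt; apply/orP; left; apply/eqP; rewrite /c; field.
  by rewrite (gt_eqF alo0) nat1r pnatr_eq0.
have kM : (Num.bound (c / e) <= k_ n)%N.
  have h : forall k a, 0 < a <= ahi -> n%:R = a * 2 ^+ k -> (Num.bound (c / e) <= k)%N.
    by near: n; exact: level_ge.
  by apply: h nE; rewrite a0.
rewrite ler_pdivrMr ?ltr0n// mulrC -ler_pdivrMr//.
apply: (le_trans (ltW (archi_boundP _))); first by rewrite divr_ge0// ltW.
by rewrite ler_nat ltnW.
Unshelve. all: by end_near.
Qed.

Lemma local_tight e : 0 < e -> exists r, \forall n \near \oo,
  I n (fun y => (r < `|y|)%R%:R) <= e /\ J n (fun y => (r < `|y|)%R%:R) <= e.
Proof.
move=> e0.
pose L := `|log2 alo| + `|log2 ahi|.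
(* [C1] and [C2] bound the two variance constants and [cb] both centres, uniformly in a; rho >= 1
   and rho >= 4C/e give 4C/rho^2 <= e. *)
pose C1 := (ahi / 2) ^+ m.+1 * (2 / alo).
pose C2 := alo^-1 + (alo ^+ 2)^-1.
pose cb := 2 * m%:R / alo + L + 2 * (ahi + m.+1%:R) / alo.
pose rho := 1 + 4 * `|C1| / e + 4 * C2 / e.
have C20 : 0 <= C2 by rewrite addr_ge0 ?invr_ge0 ?exprn_ge0 ?(ltW alo0).
have r1 : 0 <= 4 * `|C1| / e by rewrite divr_ge0 ?mulr_ge0// ltW.
have r2 : 0 <= 4 * C2 / e by rewrite divr_ge0 ?mulr_ge0// ltW.
have rho1 : 1 <= rho by rewrite /rho; lra.
have rho0 : 0 < rho by lra.
have small C : C <= `|C1| \/ C <= C2 -> 4 * C / rho ^+ 2 <= e.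
  move=> CC; rewrite ler_pdivrMr ?exprn_gt0//.
  have h : rho <= rho ^+ 2 by rewrite expr2 ler_peMr//; lra.
  rewrite -ler_pdivrMl//; apply: le_trans h.
  have -> : e^-1 * (4 * C) = (4 / e) * C by ring.
  have h4 : 0 <= 4 / e by rewrite divr_ge0// ltW.
  have [h|h] : (4 / e) * C <= 4 * `|C1| / e \/ (4 / e) * C <= 4 * C2 / e.
    have E x : 4 * x / e = (4 / e) * x by ring.
    by rewrite !E; case: CC => ?; [left|right]; rewrite ler_wpM2l.
  - by rewrite /rho; lra.
  - by rewrite /rho; lra.
exists (rho + cb); near=> n.
have [/andP[al ah] nE kK cfW] : [/\ alo <= a_ n <= ahi, n%:R = a_ n * 2 ^+ k_ n,
  (k_ n < K_ n)%N & has_cfW (mu_ n) (a_ n)] by near: n.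
have mn : (m.+1 <= n)%N by near: n; exact: nbhs_infty_ge.
have a0 : 0 < a_ n by exact: lt_le_trans al.
have ahi0 : 0 <= ahi by rewrite (le_trans _ ah)// ltW.
have an : 2 * ahi < n%:R by near: n; exact: nbhs_infty_gtr.
have aV : (a_ n)^-1 <= alo^-1 by rewrite lef_pV2.
have La : `|log2 (a_ n)| <= L by apply: norm_log2_le; rewrite ?al.
have s1 : 2 * m%:R / a_ n <= 2 * m%:R / alo by rewrite ler_wpM2l// mulr_ge0.
have s0 : 0 <= 2 * m%:R / a_ n by rewrite divr_ge0 ?mulr_ge0// ltW.
have s2 : 2 * (a_ n + m.+1%:R) / a_ n <= 2 * (ahi + m.+1%:R) / alo.
  apply: ler_pM => //; first by rewrite mulr_ge0// addr_ge0// ltW.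
    by rewrite invr_ge0 ltW.
  by rewrite ler_wpM2l// lerD2r.
have s20 : 0 <= 2 * (ahi + m.+1%:R) / alo.
  by rewrite divr_ge0 ?mulr_ge0 ?addr_ge0// ltW.
split.
- apply: (@le_trans _ _ (I n (fun y => (rho + `|cfg_center n (k_ n) (a_ n) m| < `|y|)%R%:R))).
    apply: pf_far_le; first exact: posfun_cfg.
    rewrite lerD2l; apply: (le_trans (cfg_center_le a0 nE mn _)); first by lra.
    rewrite /cb; lra.
  apply: (le_trans (cfg_far_le a0 nE kK mn _ rho0)); first by lra.
  apply: small; left; apply: le_trans (ler_norm _).
  apply: ler_pM; [exact: top_lim_ge0|by rewrite divr_ge0// ltW| |].
    by apply: top_lim_le; rewrite a0.
  by rewrite ler_wpM2l.
- have c01 := mix_weight01 m a0.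
  apply: (@le_trans _ _ (J n (fun y => (rho + `|2 * m%:R / a_ n - log2 (a_ n)| < `|y|)%R%:R))).
    apply: pf_far_le; first by apply: posfun_mix; case/andP: c01.
    rewrite lerD2l; apply: (le_trans (ler_normB _ _)); rewrite ger0_norm// /cb; lra.
  apply: (le_trans (mix_far_le a0 cfW _ c01 rho0)).
  apply: small; right; rewrite /C2 lerD// lef_pV2 ?posrE ?exprn_gt0//.
  by rewrite lerXn2r ?nnegrE// ltW.
Unshelve. all: by end_near.
Qed.

Lemma local_smooth e : 0 < e -> exists2 h, 0 < h & \forall n \near \oo,
  forall z, J n (fun y => (`|y - z| <= h)%R%:R) <= e.
Proof.
move=> e0.
(* N >= 8/e and T >= 128/e make 4/N and 64/T at most e/2; the summand |ahi| ensures T >= a. *)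
pose N := (Num.bound (8 / e)).+1.
pose T := `|ahi| + 128 / e.
have e80 : 0 <= 8 / e by rewrite divr_ge0// ltW.
have T1 : 128 / e <= T by rewrite /T lerDr.
have T0 : 0 < T by rewrite (lt_le_trans _ T1)// divr_gt0.
have N0 : 0 < N%:R :> R by rewrite ltr0n.
exists (N%:R * T)^-1; first by rewrite invr_gt0 mulr_gt0.
near=> n => z.
have [/andP[al ah] nE kK cfW] : [/\ alo <= a_ n <= ahi, n%:R = a_ n * 2 ^+ k_ n,
  (k_ n < K_ n)%N & has_cfW (mu_ n) (a_ n)] by near: n.
have a0 : 0 < a_ n by exact: lt_le_trans al.
have c01 := mix_weight01 m a0.
apply: (le_trans (@mix_small_ball _ _ _ a0 cfW _ _ T N _ z c01 _ _ _)) => //.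
- by rewrite (le_trans ah)// (le_trans (ler_norm _))// /T lerDl divr_ge0// ltW.
- by rewrite mulfV// gt_eqF// mulr_gt0.
have h1 : 4 / N%:R <= e / 2.
  rewrite ler_pdivrMr// mulrAC ler_pdivlMr//.
  have : 8 / e <= N%:R.
    by rewrite (le_trans (ltW (archi_boundP e80)))// ler_nat.
  rewrite ler_pdivrMr//; lra.
have h2 : 64 / T <= e / 2.
  by rewrite ler_pdivrMr//; move: T1; rewrite ler_pdivrMr//; lra.
lra.
Unshelve. all: by end_near.
Qed.

Theorem local_limit e : 0 < e -> \forall n \near \oo, forall x,
  `|I n (fun y => (y <= x)%R%:R) - J n (fun y => (y <= x)%R%:R)| <= e.
Proof.
apply: cdf_unif_cvg.
- near=> n.
  have [/andP[al ah] nE kK cfW] : [/\ alo <= a_ n <= ahi, n%:R = a_ n * 2 ^+ k_ n,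
    (k_ n < K_ n)%N & has_cfW (mu_ n) (a_ n)] by near: n.
  split; first exact: posfun_cfg.
  by apply: posfun_mix; case/andP: (mix_weight01 m (lt_le_trans alo0 al)).
- near=> n.
  have [/andP[al ah] nE kK cfW] : [/\ alo <= a_ n <= ahi, n%:R = a_ n * 2 ^+ k_ n,
    (k_ n < K_ n)%N & has_cfW (mu_ n) (a_ n)] by near: n.
  split; first exact: cfg_mass_le1.
  by rewrite /J mix_cst mulr1; case/andP: (mix_weight01 m (lt_le_trans alo0 al)).
- exact: local_cf_cvg.
- exact: local_tight.
- exact: local_smooth.
Unshelve. all: by end_near.
Qed.

Theorem local_mass e : 0 < e -> \forall n \near \oo,
  `|I n (fun=> 1) - mix_weight (a_ n) m| <= e.
Proof.
move=> e0; have /cvgrPdist_le /(_ _ e0) := local_cf_cvg 0.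
apply: filterS => n; rewrite sub0r normrN ger0_norm ?addr_ge0//.
apply: le_trans; rewrite /cf_dist.
have -> : (fun y : R => cos (0 * y)) = fun=> 1.
  by apply/funext => y; rewrite mul0r cos0.
by rewrite {1}/J mix_cst mulr1 lerDl.
Qed.

End local_limit.

(** * The mixture over (j, m) *)

Section exponential_series.
Variable R : realType.
Implicit Types x y z : R.

Lemma series_exp_coeff_le M N x : 0 <= x -> (M <= N)%N ->
  series (exp_coeff x) M <= series (exp_coeff x) N.
Proof.
move=> x0 /subnKC <-; elim: (N - M)%N => [|p ih]; first by rewrite addn0.
rewrite addnS; apply: (le_trans ih).
by rewrite /series/= big_nat_recr//= lerDl exp_coeff_ge0.
Qed.

Lemma series_exp_coeff_lim x : series (exp_coeff x) @ \oo --> expR x.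
Proof. exact: is_cvg_series_exp_coeff. Qed.

Lemma series_exp_coeff_le_expR M x : 0 <= x -> series (exp_coeff x) M <= expR x.
Proof.
move=> x0; apply: (cvgr_to_ge (@series_exp_coeff_lim x)); near=> N.
by apply: series_exp_coeff_le => //; near: N; exact: nbhs_infty_ge.
Unshelve. all: by end_near.
Qed.

(** Lets one truncation index, chosen at the largest argument, serve every row of the mixture. *)
Lemma exp_tail_mono M x y : 0 <= x -> x <= y ->
  expR x - series (exp_coeff x) M <= expR y - series (exp_coeff y) M.
Proof.
move=> x0 xy.
have cv z : series (exp_coeff z) N - series (exp_coeff z) M @[N --> \oo] -->
    expR z - series (exp_coeff z) M.
  by apply: cvgB; [exact: series_exp_coeff_lim|exact: cvg_cst].
rewrite -subr_ge0; apply: (cvgr_to_ge (cvgB (cv y) (cv x))); near=> N.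
have MN : (M <= N)%N by near: N; exact: nbhs_infty_ge.
have E z : series (exp_coeff z) N - series (exp_coeff z) M =
    \sum_(M <= k < N) exp_coeff z k.
    have -> : series (exp_coeff z) N = series (exp_coeff z) M + \sum_(M <= k < N) exp_coeff z k.
      by rewrite /series/= (big_cat_nat _ MN).
    by rewrite addrC addKr.
rewrite -[leRHS]/((series (exp_coeff y) N - series (exp_coeff y) M) -
  (series (exp_coeff x) N - series (exp_coeff x) M)).
rewrite !E -sumrB; apply: sumr_ge0 => k _; rewrite subr_ge0 /exp_coeff/=.
by rewrite ler_wpM2r ?invr_ge0// lerXn2r ?nnegrE// (le_trans x0).
Unshelve. all: by end_near.
Qed.

End exponential_series.

Section mixture_weights.
Variable R : realType.
Implicit Types (g : R) (j : int) (m J M : nat).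

(* As in [Gstar], the second index is the multiplicity minus one. *)
Definition mixw g (p : int * nat) : R := r_jg p.1 g p.2.+1 * p_jg p.1 g.

(** The normalisation of the conditioned Poisson law cancels: 1 - e^(-l) = e^(-l) (e^l - 1). *)
Lemma mixwE g p : 0 < g -> let l := g * pow2neg R p.1 in
  mixw g p = l ^+ p.2.+1 / (p.2.+1)`!%:R * expR (- (2 * l)).
Proof.
move=> g0 l; have l0 : 0 < l by rewrite mulr_gt0// pow2z_gt0.
have e1 : expR l - 1 != 0 by have := expR_gt1Dx (lt0r_neq0 l0) => h; rewrite gt_eqF//; lra.
rewrite /mixw /r_jg /p_jg [pow2neg R p.1 * g]mulrC -/l.
have -> : expR (- (2 * l)) = expR (- l) * expR (- l) by rewrite -expRD; congr expR; ring.
have -> : 1 - expR (- l) = expR (- l) * (expR l - 1).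
  by rewrite mulrBr mulr1 mulrC expRxMexpNx_1.
by field; rewrite ?e1 /= pnatr_eq0 -lt0n fact_gt0.
Qed.

Lemma mixw_ge0 g p : 0 < g -> 0 <= mixw g p.
Proof.
move=> g0; rewrite mixwE//; apply: mulr_ge0; last exact: expR_ge0.
by apply: divr_ge0 => //; apply: exprn_ge0; rewrite mulr_ge0 ?ltW ?pow2z_gt0.
Qed.

(** A maximum of index j leaves the other variables truncated at half of it, index j - 1, so a = 2l
    and the Poisson parameter a/2 is l. *)
Lemma mixw_mix_weight g p : 0 < g ->
  mixw g p = mix_weight (g * pow2neg R (p.1 - 1)) p.2.
Proof.
move=> g0; rewrite mixwE// /mix_weight /top_lim.
have -> : g * pow2neg R (p.1 - 1) = 2 * (g * pow2neg R p.1).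
  by rewrite !pow2negE (pow2z_subn R p.1 1) expr1; field; rewrite gt_eqF ?pow2z_gt0.
by congr (_ ^+ _ / _ * _); field.
Qed.

Definition box J M : seq (int * nat) :=
  [seq (i%:Z - J%:Z, m) | i <- iota 0 J.*2.+1, m <- iota 0 M].

Lemma mem_box J M j m : (absz j <= J)%N -> (m < M)%N -> (j, m) \in box J M.
Proof.
move=> jJ mM; apply/allpairsP; exists (absz (j + J%:Z), m); split; last first.
- by congr pair => /=; lia.
- by rewrite mem_iota.
- by rewrite mem_iota /=; lia.
Qed.

Lemma box_uniq J M : uniq (box J M).
Proof.
apply: allpairs_uniq; rewrite ?iota_uniq// => -[i m] [i' m'] _ _ /= [h ->].
by congr pair; lia.
Qed.

Lemma box_le J M p : p \in box J M -> (absz p.1 <= J)%N.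
Proof.
by case/allpairsP => -[i m] [hi _ ->]; move: hi; rewrite mem_iota /=; lia.
Qed.

Lemma sum_box J M (F : int * nat -> R) :
  \sum_(p <- box J M) F p = \sum_(i < J.*2.+1) \sum_(m < M) F (i%:Z - J%:Z, m : nat).
Proof.
rewrite big_allpairs_dep/= -(big_mkord xpredT (fun i => \sum_(m < M) F (i%:Z - J%:Z, m : nat))).
by rewrite /index_iota subn0; apply: eq_bigr => i _; rewrite -(big_mkord xpredT (fun m => F (i%:Z - J%:Z, m))) /index_iota subn0.
Qed.

Let lam g J i : R := g * 2 ^+ J / 2 ^+ i.

Lemma sum_mixw_row g J M i : 0 < g ->
  \sum_(m < M) mixw g (i%:Z - J%:Z, m : nat) =
  expR (- (2 * lam g J i)) * (series (exp_coeff (lam g J i)) M.+1 - 1).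
Proof.
move=> g0; rewrite /series/= big_nat_recl//.
have -> : exp_coeff (lam g J i) 0 = 1 by rewrite /exp_coeff/= expr0 fact0 divr1.
rewrite [1 + _]addrC addrK.
rewrite big_mkord mulr_sumr; apply: eq_bigr => m _; rewrite mixwE//=.
have -> : g * pow2neg R (i%:Z - J%:Z) = lam g J i.
  rewrite pow2negE pow2z_subn -exprnP /lam; field.
  by rewrite !expf_neq0.
by rewrite mulrC.
Qed.

(** A full row has mass e^(-lam) - e^(-2 lam), and lam halves from one row to the next. *)
Lemma telescope_rows g J n : 0 < g ->
  \sum_(i < n.+1) expR (- (2 * lam g J i)) * (expR (lam g J i) - 1) =
  expR (- lam g J n) - expR (- (2 * lam g J 0)).
Proof.
move=> g0; have E i : expR (- (2 * lam g J i)) * (expR (lam g J i) - 1) =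
    expR (- lam g J i) - expR (- (2 * lam g J i)).
  by rewrite mulrBr mulr1 -expRD; congr (expR _ - _); ring.
elim: n => [|n ih]; first by rewrite big_ord1 E.
rewrite big_ord_recr/= ih E.
have -> : 2 * lam g J n.+1 = lam g J n by rewrite /lam exprS; field; rewrite expf_neq0.
ring.
Qed.

Lemma lam_gt0 g J i : 0 < g -> 0 < lam g J i.
Proof. by move=> g0; rewrite divr_gt0 ?exprn_gt0// mulr_gt0 ?exprn_gt0. Qed.

Lemma sum_mixw_box_le1 g J M : 0 < g -> \sum_(p <- box J M) mixw g p <= 1.
Proof.
move=> g0; rewrite sum_box.
apply: (@le_trans _ _ (\sum_(i < J.*2.+1) expR (- (2 * lam g J i)) * (expR (lam g J i) - 1))).
  apply: ler_sum => i _; rewrite sum_mixw_row// ler_wpM2l ?expR_ge0// lerB//.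
  exact/series_exp_coeff_le_expR/ltW/lam_gt0.
rewrite telescope_rows//.
have h1 : expR (- lam g J J.*2) <= 1.
  by rewrite -[leRHS]expR0 ler_expR oppr_le0 ltW// lam_gt0.
have := expR_ge0 (- (2 * lam g J 0)); lra.
Qed.

Lemma box_mass e : 0 < e -> exists J M, forall g, 1/2 <= g <= 1 ->
  1 - e <= \sum_(p <- box J M) mixw g p.
Proof.
move=> e0.
(* The telescoped mass is e^(-lam) at the last row, where lam <= 2^(-J), minus e^(-2 lam) at the
   first, where 2 lam >= 2^J: each end loses at most 2^(-J). *)
have [J hJ] : exists J, 2 * (2 ^+ J)^-1 <= e / 2.
  exists (Num.bound (4 / e)).
  have h := archi_boundP (_ : 0 <= 4 / e); have {}h := h ltac:(by rewrite divr_ge0// ltW).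
  rewrite ler_pdivrMr ?exprn_gt0//.
  have : 4 / e <= 2 ^+ Num.bound (4 / e).
    by rewrite (le_trans (ltW h))// -natrX ler_nat ltnW// ltn_expl.
  rewrite ler_pdivrMr//; lra.
pose L : R := 2 ^+ J.
have L0 : 0 < L by exact: exprn_gt0.
have L1 : 1 <= L by rewrite exprn_ege1// ler1n.
(* The other e/2 is shared among the 2J + 1 rows, whose arguments are all at most L. *)
pose d := e / 2 / J.*2.+1%:R.
have d0 : 0 < d by rewrite !divr_gt0.
have [M hM] : exists M, expR L - series (exp_coeff L) M.+1 <= d.
  have /cvgrPdist_le /(_ _ d0) [M _ /(_ M.+1 (leqnSn _))] := @series_exp_coeff_lim _ L.
  by move=> /(le_trans (ler_norm _)) h; exists M.
exists J, M => g /andP[g1 g2].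
have g0 : 0 < g by lra.
rewrite sum_box.
apply: (@le_trans _ _ (\sum_(i < J.*2.+1)
    (expR (- (2 * lam g J i)) * (expR (lam g J i) - 1) - d))); last first.
  apply: ler_sum => i _; rewrite sum_mixw_row//.
  have l0 := lam_gt0 J i g0.
  have lL : lam g J i <= L.
    rewrite /lam ler_pdivrMr ?exprn_gt0// [leRHS]mulrC.
    apply: ler_wpM2r; first exact: ltW.
    by rewrite (le_trans g2)// exprn_ege1// ler1n.
  have h := le_trans (exp_tail_mono M.+1 (ltW l0) lL) hM.
  have e1 : expR (- (2 * lam g J i)) <= 1 by rewrite -[leRHS]expR0 ler_expR oppr_le0; lra.
  have e2 := expR_gt0 (- (2 * lam g J i)).
  have t0 : series (exp_coeff (lam g J i)) M.+1 <= expR (lam g J i).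
    by apply: series_exp_coeff_le_expR; exact: ltW.
  rewrite lerBlDr -lerBlDl -mulrBr.
  have -> : expR (lam g J i) - 1 - (series (exp_coeff (lam g J i)) M.+1 - 1) =
    expR (lam g J i) - series (exp_coeff (lam g J i)) M.+1 by ring.
  by apply: le_trans h; rewrite ler_piMl// subr_ge0.
rewrite sumrB telescope_rows// sumr_const card_ord -[d *+ _]mulr_natr divfK ?pnatr_eq0//.
have h1 : 1 - L^-1 <= expR (- lam g J J.*2).
  apply: le_trans (expR_ge1Dx _); rewrite lerD2l lerN2 /lam -addnn exprD.
  have -> : g * 2 ^+ J / (2 ^+ J * 2 ^+ J) = g * L^-1.
    by rewrite /L; field; rewrite expf_neq0.
  by rewrite ler_piMl// invr_ge0 ltW.
have h2 : expR (- (2 * lam g J 0)) <= L^-1.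
  have lE : 2 * lam g J 0 = 2 * g * L by rewrite /lam /L expr0 divr1; ring.
  rewrite lE; apply: (le_trans (expR_neg_le _)); first by rewrite !mulr_ge0 ?ltW.
  have h3 : L <= 2 * g * L by apply: ler_peMl; [exact: ltW|lra].
  by rewrite lef_pV2 ?posrE//; lra.
rewrite /= in hJ; rewrite -/L in hJ; lra.
Unshelve. all: by end_near.
Qed.

End mixture_weights.

Section box_sums.
Variable R : realType.

Lemma sum_subset_le (T : eqType) (s s' : seq T) (F : T -> R) :
  uniq s -> uniq s' -> {subset s <= s'} -> (forall x, 0 <= F x) ->
  \sum_(x <- s) F x <= \sum_(x <- s') F x.
Proof.
move=> us us' ss F0.
have -> : \sum_(x <- s) F x = \sum_(x <- s' | x \in s) F x.
  transitivity (\sum_(x <- [seq x <- s' | x \in s]) F x); last by rewrite big_filter.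
  apply: perm_big; apply: uniq_perm => //; first exact: filter_uniq.
  move=> x; rewrite mem_filter; case: (boolP (x \in s)) => //= /ss ->//.
rewrite [leRHS](bigID (mem s))/= lerDl; exact: sumr_ge0.
Qed.

Lemma box_subset J J' M M' : (J <= J')%N -> (M <= M')%N ->
  {subset box J M <= box J' M'}.
Proof.
move=> JJ MM [j m] h; have hj := box_le h.
apply: mem_box; first exact: leq_trans JJ.
by case/allpairsP: h => -[i m'] [_ +  [_ ->]]; rewrite mem_iota /=; lia.
Qed.

Lemma ex_box (s : seq (int * nat)) J M : exists J' M',
  [/\ (J <= J')%N, (M <= M')%N & {subset s <= box J' M'}].
Proof.
elim: s => [|[j m] s [J' [M' [JJ MM ss]]]]; first by exists J, M; split.
exists (maxn (absz j) J'), (maxn m.+1 M'); split; try by lia.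
move=> p; rewrite inE => /predU1P[->|/ss].
  by apply: mem_box; lia.
by apply: box_subset; lia.
Qed.

(** Any finite set lies in a larger box; outside the given box F is dominated by [mixw], whose total
    mass is at most 1. *)
Lemma esum_box_bounds (F : int * nat -> R) (g : R) J M : 0 < g ->
  (forall p, 0 <= F p <= mixw g p) ->
  ((\sum_(p <- box J M) F p)%:E <= \esum_(p in [set: int * nat]) (F p)%:E /\
   \esum_(p in [set: int * nat]) (F p)%:E <=
     (\sum_(p <- box J M) F p + (1 - \sum_(p <- box J M) mixw g p))%:E)%E.
Proof.
move=> g0 FW.
have F0 p : 0 <= F p by case/andP: (FW p).
split.
  apply: esum_ge; exists [set` box J M]; first by split => //; exact: finite_seq.
  by rewrite -fsbig_seq ?box_uniq// sumEFin.
apply: ge_ereal_sup => _ [A [fA _] <-].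
rewrite fsbig_finite//= sumEFin lee_fin.
have [J' [M' [JJ MM ss]]] := ex_box (finmap.enum_fset (fset_set A)) J M.
apply: (@le_trans _ _ (\sum_(p <- box J' M') F p)).
  by apply: sum_subset_le => //; [exact: finmap.fset_uniq|exact: box_uniq].
have h : \sum_(p <- box J M) (mixw g p - F p) <= \sum_(p <- box J' M') (mixw g p - F p).
  apply: sum_subset_le; [exact: box_uniq|exact: box_uniq|exact: box_subset|].
  by move=> p; rewrite subr_ge0; case/andP: (FW p).
rewrite !sumrB in h.
have := sum_mixw_box_le1 J' M' g0; lra.
Qed.

End box_sums.

(** * Elementary events *)

Section events.
Context {R : realType} {d : measure_display} {T : measurableType d}.
Variables (P : probability T R) (X : nat -> {RV P >-> R}).
Hypothesis indepX : mutually_independent P (fun i => (X i : T -> R)).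
Hypothesis lawX : forall i k : nat, (0 < k)%N ->
  P (X i @^-1` [set (2 : R) ^+ k]) = (((2 : R) ^+ k)^-1)%:E.
Variables (n K : nat).
Hypothesis n0 : (0 < n)%N.
Implicit Types f : {ffun 'I_n -> 'I_K}.

(** Independence is stated for sequences of sets indexed by nat, so f is extended beyond n; the
    default 0 is never tested. *)
Let val_at f (i : nat) : R := if insub i is Some o then 2 ^+ (f o).+1 else 0.

Let val_atE f (i : 'I_n) : val_at f i = 2 ^+ (f i).+1.
Proof. by rewrite /val_at valK. Qed.

Definition cfg_event f : set T := \bigcap_(i < n) (X i @^-1` [set val_at f i]).

Lemma cfg_eventP f w : cfg_event f w -> forall i : 'I_n, X i w = 2 ^+ (f i).+1.
Proof. by move=> h i; rewrite -val_atE; exact: (h i (ltn_ord i)). Qed.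

Lemma measurable_cfg_event f : measurable (cfg_event f).
Proof.
apply: bigcap_measurable => [|i _]; first by exists 0%N.
rewrite -[X in measurable X]setTI; apply: measurable_funP => //.
Qed.

Lemma prob_cfg_event f : P (cfg_event f) = (cfg_weight R f)%:E.
Proof.
rewrite /cfg_event (indepX n (B := fun i => [set val_at f i])) => [|i]; last first.
  exact: measurable_set1.
congr (_%:E); apply: eq_bigr => i _.
by rewrite val_atE lawX.
Qed.

Lemma trivIset_cfg_event (D : set {ffun 'I_n -> 'I_K}) : trivIset D cfg_event.
Proof.
move=> f f' _ _ [w [/cfg_eventP h /cfg_eventP h']].
apply/ffunP => i; apply/val_inj/eqP; rewrite -eqSS.
have := h i; rewrite h' => /eqP.
by rewrite eq_le !ler_eXn2l ?ltr1n// -eqn_leq eq_sym.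
Qed.

Definition cfg_union (Q : {set {ffun 'I_n -> 'I_K}}) : set T :=
  \bigcup_(f in [set` enum Q]) cfg_event f.

Lemma measurable_cfg_union Q : measurable (cfg_union Q).
Proof.
by apply: fin_bigcup_measurable => // f _; exact: measurable_cfg_event.
Qed.

Lemma prob_cfg_union Q : P (cfg_union Q) = (\sum_(f in Q) cfg_weight R f)%:E.
Proof.
rewrite /cfg_union measure_fin_bigcup//; last 2 first.
- exact: trivIset_cfg_event.
- by move=> f _; exact: measurable_cfg_event.
rewrite -fsbig_seq ?enum_uniq//= -sumEFin big_enum/=.
by apply: eq_bigr => f _; rewrite prob_cfg_event.
Qed.

Definition trimmed (w : T) : R :=
  ((\sum_(i < n) X i w) - \big[Order.max/X 0%N w]_(i < n) X i w) / n%:R - log2 (n%:R : R).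

Lemma measurable_trimmed : measurable_fun setT trimmed.
Proof.
apply: measurable_funB => //; apply: measurable_funM => //.
apply: measurable_funB; first by apply: measurable_sum.
elim: (index_enum _) => [|i s ih].
  by under eq_fun do rewrite big_nil; exact: measurable_funPT.
by under eq_fun do rewrite big_cons; exact: measurable_maxr.
Qed.

Lemma measurable_trimmed_le x : measurable [set w | trimmed w <= x].
Proof.
have -> : [set w | trimmed w <= x] = setT `&` trimmed @^-1` [set` `]-oo, x]].
  by apply/seteqP; split => w /=; rewrite in_itv//= => -[].
by apply: measurable_trimmed => //; exact: measurable_itv.
Qed.

Lemma trimmed_cfg k m f w : f \in cfg_set n K k m.+1 -> cfg_event f w ->
  trimmed w = cfg_pos R k f.
Proof.
rewrite inE => /andP[/forallP fk /eqP cf] /cfg_eventP Xf.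
rewrite /trimmed /cfg_pos /cfg_sum; congr ((_ - _) / _ - _).
  by apply: eq_bigr => i _; exact: Xf.
apply/eqP; rewrite eq_le; apply/andP; split.
  (* The default [X 0] of the maximum is itself one of the variables because n > 0. *)
  apply: bigmax_le => [|i _].
    by rewrite (Xf (Ordinal n0)) ler_eXn2l ?ltr1n// ltnS.
  by rewrite Xf ler_eXn2l ?ltr1n// ltnS.
have [i /eqP fi] : exists i, i \in [pred i | f i == k :> nat].
  by apply/card_gt0P; rewrite cf.
by rewrite -fi -Xf; exact: le_bigmax.
Qed.

Lemma cfg_set_inj k k' m m' f : f \in cfg_set n K k m.+1 ->
  f \in cfg_set n K k' m'.+1 -> k = k' /\ m = m'.
Proof.
rewrite !inE => /andP[/forallP h /eqP c] /andP[/forallP h' /eqP c'].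
have kk : k = k'.
  apply/eqP; rewrite eqn_leq.
  have [i /eqP fi] : exists i, i \in [pred i | f i == k :> nat].
    by apply/card_gt0P; rewrite c.
  have [i' /eqP fi'] : exists i, i \in [pred i | f i == k' :> nat].
    by apply/card_gt0P; rewrite c'.
  by apply/andP; split; [rewrite -fi; exact: h'|rewrite -fi'; exact: h].
by split=> //; move: c; rewrite kk c' => -[].
Qed.

Variables (A : seq (int * nat)) (kap : int * nat -> nat).
Hypothesis uA : uniq A.
Hypothesis kap_inj : forall p p', p \in A -> p' \in A ->
  kap p = kap p' -> p.2 = p'.2 -> p = p'.

(** A configuration lies in at most one listed class, so the double sum runs over distinct
    elementary events and becomes a probability. *)
Lemma sum_cfg_classes (c : int * nat -> {ffun 'I_n -> 'I_K} -> bool) :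
  \sum_(p <- A) \sum_(f in cfg_set n K (kap p) p.2.+1) cfg_weight R f * (c p f)%:R =
  \sum_(f in finset (fun f => has (fun p => (f \in cfg_set n K (kap p) p.2.+1) && c p f) A))
    cfg_weight R f.
Proof.
under eq_bigr do rewrite big_mkcond/=.
rewrite exchange_big/= [RHS]big_mkcond/=; apply: eq_bigr => f _.
rewrite finset.in_set; case: hasP => [[p pA /andP[fp cp]]|no].
  rewrite (bigD1_seq p)//= fp cp mulr1 big1_seq ?addr0// => p' /andP[pp p'A].
  case: ifP => // fp'; have [h1 h2] := cfg_set_inj fp fp'.
  by rewrite (kap_inj pA p'A h1 h2) eqxx in pp.
rewrite big1_seq// => p /andP[_ pA]; case: ifP => // fp.
by case cp : (c p f); rewrite ?mulr0//; exfalso; apply: no; exists p; rewrite ?fp.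
Qed.

(** The upper bound is the lower bound for the complementary event, so the only loss is the mass
    missing from the listed classes. *)
Lemma prob_trimmed_bounds x :
  let H p := @cfg_fun R n K (kap p) p.2.+1 (fun y => (y <= x)%R%:R) in
  \sum_(p <- A) H p <= fine (P [set w | trimmed w <= x]) /\
  fine (P [set w | trimmed w <= x]) <=
    \sum_(p <- A) H p + (1 - \sum_(p <- A) @cfg_fun R n K (kap p) p.2.+1 (fun=> 1)).
Proof.
move=> H.
have mE := measurable_trimmed_le x.
set E := [set w | trimmed w <= x] in mE *.
have PfinE : P E = (fine (P E))%:E by rewrite fineK// fin_num_measure.
pose Qc c : {set {ffun 'I_n -> 'I_K}} :=
  finset (fun f => has (fun p => (f \in cfg_set n K (kap p) p.2.+1) && c p f) A).
have sumH : \sum_(p <- A) H p =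
    \sum_(f in Qc (fun p f => cfg_pos R (kap p) f <= x)) cfg_weight R f.
  exact: sum_cfg_classes.
have sumN : \sum_(p <- A) (@cfg_fun R n K (kap p) p.2.+1 (fun=> 1) - H p) =
    \sum_(f in Qc (fun p f => ~~ (cfg_pos R (kap p) f <= x))) cfg_weight R f.
  rewrite -sum_cfg_classes; apply: eq_bigr => p _.
  rewrite /H /cfg_fun -sumrB; apply: eq_bigr => f _.
  by case: (_ <= x); rewrite ?subrr ?mulr1 ?mulr0 ?subr0.
split.
  rewrite -lee_fin -PfinE sumH -prob_cfg_union; apply: le_measure.
  - by rewrite inE; exact: measurable_cfg_union.
  - by rewrite inE.
  - move=> w [f /=]; rewrite mem_enum finset.in_set => /hasP[p pA /andP[fp px]] fw.
    by rewrite /E/= (trimmed_cfg fp fw).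
have PC : fine (P (~` E)) = 1 - fine (P E).
  by rewrite probability_setC// PfinE -EFinB.
have : \sum_(p <- A) (@cfg_fun R n K (kap p) p.2.+1 (fun=> 1) - H p) <= fine (P (~` E)).
  rewrite sumN -lee_fin -prob_cfg_union fineK; last first.
    by rewrite fin_num_measure//; exact: measurableC.
  apply: le_measure.
  - by rewrite inE; exact: measurable_cfg_union.
  - by rewrite inE; exact: measurableC.
  - move=> w [f /=]; rewrite mem_enum finset.in_set => /hasP[p pA /andP[fp /negP px]] fw.
    by rewrite /E/= (trimmed_cfg fp fw).
rewrite PC sumrB; lra.
Qed.

End events.

(** * Levels, gamma_n and the passage to a finite box *)

Section instantiation.
Variable R : realType.

Definition ceil2 (n : nat) : int := Num.ceil (log2 (n%:R : R)).
Definition gamma_n (n : nat) : R := n%:R / (2 : R) ^ ceil2 n.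
(* The maximum 2^(ceil(log2 n) + j) is 2^((level n p).+1); [absz] is harmless for large n. *)
Definition level (n : nat) (p : int * nat) : nat := absz (ceil2 n + p.1 - 1)%R.

Lemma gamma_n_itv n : (0 < n)%N -> 1/2 <= gamma_n n <= 1.
Proof.
move=> n0; have n0' : 0 < n%:R :> R by rewrite ltr0n.
have /andP[h1 h2] := ceil_itv (log2 (n%:R : R)).
rewrite /gamma_n; apply/andP; split.
  rewrite ler_pdivlMr ?pow2z_gt0//.
  have -> : 1 / 2 * (2 : R) ^ ceil2 n = 2 `^ (ceil2 n - 1)%:~R.
    by rewrite powR_intmul// (pow2z_subn R (ceil2 n) 1) expr1 mul1r mulrC.
  by rewrite -[leRHS]powR_log2// ler_powR ?ler1n// ltW.
rewrite ler_pdivrMr ?pow2z_gt0// mul1r -[leLHS]powR_log2// -powR_intmul//.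
by rewrite ler_powR ?ler1n.
Qed.

Lemma level_ge0 j : \forall n \near \oo, 0 <= ceil2 n + j - 1.
Proof.
near=> n.
have h : (2 : R) ^ (- j) < n%:R by near: n; exact: nbhs_infty_gtr.
have : (- j < ceil2 n)%R.
  by rewrite /ceil2 ceil_gt_int -log2_pow2z ltr_log2// pow2z_gt0.
lia.
Unshelve. all: by end_near.
Qed.

Lemma level_nE n p : (0 < n)%N -> 0 <= ceil2 n + p.1 - 1 ->
  n%:R = gamma_n n * pow2neg R (p.1 - 1) * 2 ^+ level n p.
Proof.
move=> n0 lv; rewrite exprnP /level gez0_abs// /gamma_n pow2negE.
rewrite -addrA.
rewrite [2 ^ (ceil2 n + _)]expfzDr ?pnatr_eq0//.
have cancel (x c c' : R) : c != 0 -> c' != 0 -> x / c / c' * (c * c') = x.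
  by move=> c0 c'0; field; rewrite ?c0 ?c'0.
by rewrite cancel ?gt_eqF ?pow2z_gt0.
Qed.

Variable G : int -> R -> R -> R.
Hypothesis GW : forall (j : int) (g : R), 1/2 <= g <= 1 -> is_df_W j g (G j g).

Definition Gterm (g x : R) (p : int * nat) : R :=
  G (p.1 - 1) g (x - p.2%:R * (2 : R) ^ p.1 / g) * r_jg p.1 g p.2.+1 * p_jg p.1 g.

Lemma Gterm_bounds g x p : 1/2 <= g <= 1 -> 0 <= Gterm g x p <= mixw g p.
Proof.
move=> g1; have g0 : 0 < g by lra.
rewrite /Gterm -mulrA -/(mixw g p).
have w0 := mixw_ge0 p g0.
have [mu [_ [_ [-> _]]]] := GW (p.1 - 1) g1.
set B := [set` _].
have mB : measurable B by exact: measurable_itv.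
have h0 : 0 <= fine (mu B) by rewrite fine_ge0.
have h1 : fine (mu B) <= 1.
  by rewrite -lee_fin fineK ?fin_num_measure// probability_le1.
by rewrite mulr_ge0//= ler_piMl.
Qed.

Lemma Gterm_limit (p : int * nat) (K : nat -> nat) e :
  (\forall n \near \oo, (level n p < K n)%N) -> 0 < e ->
  \forall n \near \oo,
    (forall x, `|@cfg_fun R n (K n) (level n p) p.2.+1 (fun y => (y <= x)%R%:R) -
                Gterm (gamma_n n) x p| <= e) /\
    `|@cfg_fun R n (K n) (level n p) p.2.+1 (fun=> 1) - mixw (gamma_n n) p| <= e.
Proof.
move=> levK e0.
(* For this pair the parameter is a = gamma_n s, which stays in [s/2, s]. *)
pose s := pow2neg R (p.1 - 1).
have s0 : 0 < s by exact: pow2z_gt0.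
(* The law behind [G] is only known to exist, for each n separately; n = 0, where gamma_n vanishes,
   receives an irrelevant law. *)
have /choice[mu_ hmu] : forall n, exists mu : probability R R, (0 < n)%N ->
    (forall x, G (p.1 - 1) (gamma_n n) x = fine (mu [set` `]-oo, x]])) /\
    has_cfW mu (gamma_n n * s).
  move=> [|n].
    by have [|mu _] := GW (p.1 - 1) (_ : 1/2 <= (1 : R) <= 1); [lra|exists mu].
  have g1 := gamma_n_itv (ltn0Sn n); have g0 : 0 < gamma_n n.+1 by lra.
  by have [mu h] := is_df_W_cf g0 (GW (p.1 - 1) g1); exists mu.
have setup : \forall n \near \oo,
    [/\ s / 2 <= gamma_n n * s <= s, n%:R = gamma_n n * s * 2 ^+ level n p,
        (level n p < K n)%N & has_cfW (mu_ n) (gamma_n n * s)].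
  near=> n.
  have n0 : (0 < n)%N by near: n; exact: nbhs_infty_gt.
  have lv : 0 <= ceil2 n + p.1 - 1 by near: n; exact: level_ge0.
  have /andP[g1 g2] := gamma_n_itv n0.
  split.
  - by apply/andP; split; nra.
  - exact: level_nE.
  - by near: n.
  - exact: (hmu n n0).2.
have s20 : 0 < s / 2 by rewrite divr_gt0.
have lim := @local_limit R (s / 2) s p.2 (fun n => gamma_n n * s) (level ^~ p) K mu_ s20 setup e e0.
have mass := @local_mass R (s / 2) s p.2 (fun n => gamma_n n * s) (level ^~ p) K mu_ s20 setup e e0.
near=> n.
have n0 : (0 < n)%N by near: n; exact: nbhs_infty_gt.
have /andP[g1 g2] := gamma_n_itv n0.
have g0 : 0 < gamma_n n by lra.
split.
- move=> x.
  have -> : Gterm (gamma_n n) x p = mix (mu_ n) (mix_weight (gamma_n n * s) p.2)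
      (2 * p.2%:R / (gamma_n n * s)) (fun y => (y <= x)%R%:R).
    rewrite mix_le -mixw_mix_weight// /Gterm (hmu n n0).1 -mulrA mulrC.
    suff -> : p.2%:R * 2 ^ p.1 / gamma_n n = 2 * p.2%:R / (gamma_n n * s) by [].
    rewrite /s pow2negE (pow2z_subn R p.1 1) expr1.
    move: (gamma_n n) g0 (2 ^ p.1) (pow2z_gt0 R p.1) => g g0 c c0.
    by field; rewrite !gt_eqF.
  by move: x; near: n; exact: lim.
- rewrite mixw_mix_weight//.
  by near: n; exact: mass.
Unshelve. all: by end_near.
Qed.

Lemma near_all_seq (T : eqType) (s : seq T) (Q : T -> nat -> Prop) :
  (forall t, t \in s -> \forall n \near \oo, Q t n) ->
  \forall n \near \oo, forall t, t \in s -> Q t n.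
Proof.
elim: s => [|t s ih] h; first by apply: nearW.
have h1 := h t (mem_head _ _).
have h2 := ih (fun u us => h u (mem_behead (s := t :: s) us)).
near=> n => u; rewrite inE => /predU1P[->|]; first by near: n.
by move: u; near: n.
Unshelve. all: by end_near.
Qed.

End instantiation.

Theorem theorem2 (R : realType) (d : measure_display) (T : measurableType d)
  (P : probability T R) (X : nat -> {RV P >-> R})
  (G : int -> R -> R -> R) :
  (* X_1, X_2, ... (here indexed X 0, X 1, ...) are independent ... *)
  mutually_independent P (fun i => (X i : T -> R)) ->
  (* ... and identically distributed with P{X_i = 2^k} = 2^{-k}, k >= 1 *)
  (forall (i k : nat), (0 < k)%N ->
     P (X i @^-1` [set (2 : R) ^+ k]) = (((2 : R) ^+ k)^-1)%:E) ->
  (* G j g is the distribution function of W_{j,g} *)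
  (forall (j : int) (g : R), 1/2 <= g <= 1 -> is_df_W j g (G j g)) ->
  forall eps : R, 0 < eps -> exists N : nat, forall n : nat, (N <= n)%N -> (0 < n)%N ->
    let gam : R := n%:R / (2 : R) ^ (Num.ceil (log2 (n%:R : R))) in
    forall x : R,
      let E := [set w | (((\sum_(i < n) X i w) - \big[Order.max/X 0%N w]_(i < n) X i w)
                          / n%:R - log2 (n%:R : R) <= x)%R] in
      (`| P E - Gstar G gam x | <= eps%:E)%E.
Proof.
move=> indepX lawX GW eps eps0.
have e4 : 0 < eps / 4 by rewrite divr_gt0.
have [J [M boxJM]] := box_mass e4.
pose A := box J M.
(* Enough values for the box: for large n the level ceil(log2 n) + j - 1 with j <= J stays below
   [K n]. *)
pose K n := (absz (ceil2 R n + J%:Z)%R).+1.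
pose d0 := eps / 4 / (size A).+1%:R.
have d00 : 0 < d0 by rewrite divr_gt0.
have near_A : \forall n \near \oo, forall p, p \in A ->
    0 <= ceil2 R n + p.1 - 1 /\
    (forall x, `|@cfg_fun R n (K n) (level R n p) p.2.+1 (fun y => (y <= x)%R%:R) -
                Gterm G (gamma_n R n) x p| <= d0) /\
    `|@cfg_fun R n (K n) (level R n p) p.2.+1 (fun=> 1) - mixw (gamma_n R n) p| <= d0.
  apply: near_all_seq => p pA.
  have lev : \forall n \near \oo, 0 <= ceil2 R n + p.1 - 1 by exact: level_ge0.
  have levK : \forall n \near \oo, (level R n p < K n)%N.
    apply: filterS lev => n; move: (box_le pA); rewrite /level /K.
    by move: (ceil2 R n) (p.1) => c q; lia.
  have lim := Gterm_limit GW levK d00.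
  near=> n; split; [by near: n|].
  by near: n; exact: lim.
have [N _ hN] := near_A; exists N => n Nn n0 gam x.
cbv zeta; set E := [set w | _].
have {hN}hA := hN n Nn.
have g1 : 1/2 <= gam <= 1 := gamma_n_itv R n0.
have g0 : 0 < gam by lra.
have inj : forall p p', p \in A -> p' \in A -> level R n p = level R n p' ->
    p.2 = p'.2 -> p = p'.
  move=> [j m] [j' m'] /hA[l1 _] /hA[l2 _] /=; rewrite /level/= => h ->.
  by congr pair; move: l1 l2 h => /=; lia.
have [b1 b2] := prob_trimmed_bounds indepX lawX (K n) n0 (box_uniq J M) inj x.
have [c1 c2] := esum_box_bounds J M g0 (fun p => Gterm_bounds GW x p g1).
have mass := boxJM _ g1.
rewrite -/A in b1 b2 c1 c2 mass.
have sizeA : (size A)%:R * d0 <= eps / 4.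
  rewrite /d0 mulrCA ler_piMr ?(ltW e4)// ler_pdivrMr// mul1r ler_nat//.
have dist (F F' : int * nat -> R) : (forall p, p \in A -> `|F p - F' p| <= d0) ->
    `|\sum_(p <- A) F p - \sum_(p <- A) F' p| <= eps / 4.
  move=> FF; rewrite -sumrB (le_trans (ler_norm_sum _ _ _))// (le_trans _ sizeA)//.
  rewrite -sum1_size natr_sum mulr_suml big_seq [leRHS]big_seq.
  by apply: ler_sum => p pA; rewrite mul1r; exact: FF.
have D1 := dist _ _ (fun p pA => (hA p pA).2.1 x).
have D2 := dist _ _ (fun p pA => (hA p pA).2.2).
have mE : measurable E by exact: (measurable_trimmed_le X n x).
have PfinE : P E = (fine (P E))%:E by rewrite fineK// fin_num_measure.
have GE : Gstar G gam x = \esum_(p in [set: int * nat]) (Gterm G gam x p)%:E by [].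
rewrite PfinE GE.
(* The two bounds exclude infinite values of the series. *)
move: c1 c2; case: (\esum_(p in _) _)%E => [y| |] //.
rewrite !lee_fin => c1 c2.
suff : `|fine (P E) - y| <= eps by rewrite -lee_fin; exact.
move: b1 b2; rewrite -/E => b1 b2.
move: D1 D2; rewrite -/gam !ler_norml => /andP[D1 D1'] /andP[D2 D2'].
(* The upper estimate of P E spends eps/4 three times: on the distribution functions, on the class
   masses and on the mass missing from the box; the lower one spends it twice, without the class
   masses. *)
apply/andP; split; lra.
Unshelve. all: by end_near.
Qed.
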